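(* The rational map $$\iota_{\mathrm{tw}}:\mathbb P^{12}\dashrightarrow\mathrm{Ch}_{\mathrm{tw}}(\mathbb P^3),\qquad m\mapsto\nu_3^{5,5}\big(\Sigma\,\wedge^2(M(m)^\top)\,\Sigma\big)^\top\omega^{\mathrm{tw}}$$ is degree-6, generically 3-to-1 and dominant.
   Context: We work over $\mathbb C$. Veronese notation: $\nu_3^5(L)\in\mathbb P^{55}$ is the vector of all degree-3 monomials in the coordinates of $L=(L_0:\cdots:L_5)$; for a $6\times6$ matrix $A$, $\nu_3^{5,5}(A)$ is the $56\times56$ matrix with $\nu_3^5(AL)=\nu_3^{5,5}(A)\nu_3^5(L)$ for all $L$. Lines in $\mathbb P^3$ are given Plücker coordinates $L=(L_0:\cdots:L_5)\in\mathrm{Gr}(1,\mathbb P^3)\subseteq\mathbb P^5$: if $L$ is spanned by $X,Y$, these are the $2\times2$ minors of $[X\ Y]^\top$ in the column order $[12],[13],[14],[23],[24],[34]$. For a $4\times4$ matrix $M$, $\wedge^2M$ is the $6\times6$ matrix sending the Plücker vector of $X,Y$ to that of $MX,MY$. $\Sigma$ is the signed permutation matrix $$\Sigma=\begin{bmatrix} 0 & 0 & 0 & 0 & 0 & 1 \\ 0 & 0 & 0 & 0 & -1 & 0 \\ 0 & 0 & 0 & 1 & 0 & 0 \\ 0 & 0 & 1 & 0 & 0 & 0 \\ 0 & -1 & 0 & 0 & 0 & 0 \\ 1 & 0 & 0 & 0 & 0 & 0 \end{bmatrix}.$$ For $m=(m_0:\cdots:m_{12})\in\mathbb P^{12}$,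 $$M(m)=\begin{bmatrix} 0 & m_0 & m_1 & m_2 \\ -m_0 & 0 & m_3 & m_4 \\ {m_5} & m_6 & m_7 & m_8 \\ {m_9} & m_{10} & m_{11} & m_{12} \end{bmatrix}.$$ The standard twisted cubic is the image of $\varphi:\mathbb P^1\to\mathbb P^3$, $(s:t)\mapsto(s^3:s^2t:st^2:t^3)$. A line $L$ meets it if and only if $$-L_3^3-L_3^2L_2+2L_4L_3L_1-L_5L_1^2-L_4^2L_0+L_5L_3L_0+L_5L_2L_0=0,$$ and $\omega^{\mathrm{tw}}$ is the coefficient vector such that this cubic equals $(\omega^{\mathrm{tw}})^\top\nu_3^5(L)$. A twisted cubic is the image of the standard twisted cubic under a full-rank $M\in\mathbb P(\mathbb C^{4\times4})$. Its Chow form is the vector $\nu_3^{5,5}(\Sigma\wedge^2(M^\top)\Sigma)^\top\omega^{\mathrm{tw}}\in\mathbb P^{55}$; it is the vector $\beta$ such that $\beta^\top\nu_3^5(L)=0$ if and only if the line $L$ meets the curve. $\mathrm{Ch}_{\mathrm{tw}}(\mathbb P^3)\subseteq\mathbb P^{55}$ is the Zariski closure of the set of twisted cubics represented by their Chow forms. ''Degree-6'' refers to the degree of the map in the entries of $m$. ''Generically 3-to-1'' means that for generic $m\in\mathbb P^{12}$ the fiber of $\iota_{\mathrm{tw}}$ through $m$ consists of exactly three points. *)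

(* Defs.v *)
From mathcomp Require Import all_boot all_order all_algebra.
From mathcomp Require Import ring reals complex mpoly.

Set Implicit Arguments.
Unset Strict Implicit.
Unset Printing Implicit Defensive.

Import GRing.Theory.
Local Open Scope ring_scope.

Section Coordinates.
Variable K : comNzRingType.

Definition mx_of_rows (p q : nat) (rows : seq (seq K)) : 'M[K]_(p, q) :=
  \matrix_(i < p, j < q) nth 0 (nth [::] rows i) j.

(* The pairs [12], [13], [14], [23], [24], [34], shifted to start at 0. *)
Definition pl_fst (k : 'I_6) : 'I_4 := inord (nth 0%N [:: 0; 0; 0; 1; 1; 2]%N k).
Definition pl_snd (k : 'I_6) : 'I_4 := inord (nth 0%N [:: 1; 2; 3; 2; 3; 3]%N k).

Definition plucker (X Y : 'cV[K]_4) : 'cV[K]_6 :=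
  \col_k (X (pl_fst k) 0 * Y (pl_snd k) 0 - X (pl_snd k) 0 * Y (pl_fst k) 0).

Definition wedge2 (M : 'M[K]_4) : 'M[K]_6 :=
  \matrix_(k, l) (M (pl_fst k) (pl_fst l) * M (pl_snd k) (pl_snd l)
                  - M (pl_fst k) (pl_snd l) * M (pl_snd k) (pl_fst l)).

Definition Sigma : 'M[K]_6 := mx_of_rows 6 6
  [:: [:: 0; 0; 0; 0; 0; 1];
      [:: 0; 0; 0; 0; -1; 0];
      [:: 0; 0; 0; 1; 0; 0];
      [:: 0; 0; 1; 0; 0; 0];
      [:: 0; -1; 0; 0; 0; 0];
      [:: 1; 0; 0; 0; 0; 0]].

(* The k-th of the 56 = 'C(8, 3) monomials of degree 3 in 6 variables, in the
   enumeration used by [size_basis] and [basis_cover] of mpoly. *)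
Definition mon3 (k : 'I_56) : 'X_{1..6} :=
  nth 0%MM [seq s2m t | t : 3.-tuple 'I_6 <- enum (basis 6 3)] k.

Definition nu3 (L : 'cV[K]_6) : 'cV[K]_56 :=
  \col_k \prod_(i < 6) L i 0 ^+ mon3 k i.

(* Row k lists the coefficients of the k-th monomial evaluated at the linear
   forms A X; see [nu3_mulmx]. *)
Definition nu3_mx (A : 'M[K]_6) : 'M[K]_56 :=
  \matrix_(k, l)
    (\prod_(i < 6) (\sum_(j < 6) A i j *: 'X_j) ^+ mon3 k i
       : {mpoly K[6]})@_(mon3 l).

Definition tw_cubic : {mpoly K[6]} :=
  let L (k : nat) : {mpoly K[6]} := 'X_(inord k) in
  - L 3%N ^+ 3 - L 3%N ^+ 2 * L 2%N + 2%:R * (L 4%N * L 3%N * L 1%N)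
  - L 5%N * L 1%N ^+ 2 - L 4%N ^+ 2 * L 0%N
  + L 5%N * L 3%N * L 0%N + L 5%N * L 2%N * L 0%N.

Definition omega_tw : 'cV[K]_56 := \col_k tw_cubic@_(mon3 k).

Definition chow_form (M : 'M[K]_4) : 'cV[K]_56 :=
  (nu3_mx (Sigma *m wedge2 M^T *m Sigma))^T *m omega_tw.

Definition Mmx (m : 'cV[K]_13) : 'M[K]_4 :=
  let c (k : nat) : K := m (inord k) 0 in
  mx_of_rows 4 4
    [:: [:: 0; c 0%N; c 1%N; c 2%N];
        [:: - c 0%N; 0; c 3%N; c 4%N];
        [:: c 5%N; c 6%N; c 7%N; c 8%N];
        [:: c 9%N; c 10%N; c 11%N; c 12%N]].

Definition iota_tw (m : 'cV[K]_13) : 'cV[K]_56 := chow_form (Mmx m).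

Lemma wedge2_plucker (M : 'M[K]_4) (X Y : 'cV[K]_4) :
  wedge2 M *m plucker X Y = plucker (M *m X) (M *m Y).
Proof.
apply/colP => k; rewrite !mxE.
under eq_bigr do rewrite !mxE.
rewrite !big_ord_recl !big_ord0 /pl_fst /pl_snd /bump /=.
set i := inord (nth _ _ k); set j := inord (nth _ _ k).
have e0 : inord 0 = ord0 :> 'I_4 by apply/val_inj; rewrite /= inordK.
have e1 : inord 1 = lift ord0 ord0 :> 'I_4 by apply/val_inj; rewrite /= inordK.
have e2 : inord 2 = lift ord0 (lift ord0 ord0) :> 'I_4
  by apply/val_inj; rewrite /= inordK.
have e3 : inord 3 = lift ord0 (lift ord0 (lift ord0 ord0)) :> 'I_4
  by apply/val_inj; rewrite /= inordK.
rewrite !e0 !e1 !e2 !e3; ring.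
Qed.

Lemma nu3E (L : 'cV[K]_6) (k : 'I_56) :
  nu3 L k 0 = ('X_[mon3 k] : {mpoly K[6]}).@[fun i => L i 0].
Proof. by rewrite mxE mevalX. Qed.

Lemma mdeg_mon3 (k : 'I_56) : mdeg (mon3 k) = 3.
Proof. by apply/eqP; rewrite basis_cover mem_nth // size_basis. Qed.

Lemma homog3E (p : {mpoly K[6]}) : p \is 3.-homog ->
  p = \sum_(k < 56) p@_(mon3 k) *: 'X_[mon3 k].
Proof.
move=> hp; apply/mpolyP => m; rewrite raddf_sum /=.
under eq_bigr do rewrite mcoeffZ mcoeffX.
case: (mdeg m =P 3%N) => [/eqP|/eqP] hm.
  move: hm; rewrite basis_cover => hm.
  pose b : seq 'X_{1..6} := [seq s2m t | t : 3.-tuple 'I_6 <- enum (basis 6 3)].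
  have lt_b : (index m b < 56)%N by rewrite -[56%N](size_basis 5 3) index_mem.
  have e : mon3 (Ordinal lt_b) = m by apply: nth_index.
  rewrite (bigD1 (Ordinal lt_b)) //= e eqxx mulr1 big1 ?addr0 // => k nk.
  case: eqP => [ek|_]; last by rewrite mulr0.
  case/negP: nk; apply/eqP/val_inj; rewrite /= -ek index_uniq //.
    by rewrite size_basis.
  exact: uniq_basis.
rewrite (dhomog_nemf_coeff hp hm) big1 // => k _.
case: eqP => [ek|_]; last by rewrite mulr0.
by case/eqP: hm; rewrite -ek mdeg_mon3.
Qed.

Lemma meval_homog3 (p : {mpoly K[6]}) (L : 'cV[K]_6) : p \is 3.-homog ->
  p.@[fun i => L i 0] = \sum_(k < 56) p@_(mon3 k) * nu3 L k 0.
Proof.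
move=> hp; rewrite {1}(homog3E hp) raddf_sum /=.
by apply: eq_bigr => k _; rewrite mevalZ nu3E.
Qed.

Lemma nu3_mulmx (A : 'M[K]_6) (L : 'cV[K]_6) :
  nu3 (A *m L) = nu3_mx A *m nu3 L.
Proof.
apply/colP => k; rewrite [RHS]mxE.
under eq_bigr do rewrite [nu3_mx A _ _]mxE.
rewrite -meval_homog3; last first.
  suff: \prod_(i < 6) (\sum_(j < 6) A i j *: 'X_j : {mpoly K[6]}) ^+ mon3 k i
      \is (mdeg (mon3 k)).-homog by rewrite mdeg_mon3.
  rewrite mdegE.
  pose h (i : 'I_6) : {mpoly K[6]} := (\sum_(j < 6) A i j *: 'X_j) ^+ mon3 k i.
  rewrite -/(\prod_i h i).
  apply: (big_rec2 (fun (p : {mpoly K[6]}) (d : nat) => p \is d.-homog)).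
    exact: dhomog1.
  move=> i d p _ hp; apply: dhomogM hp.
  rewrite -[X in X.-homog]mul1n; apply: dhomogMn.
  by apply: rpred_sum => j _; apply: rpredZ; rewrite dhomogX; apply/eqP; exact: mdeg1.
rewrite mxE rmorph_prod /=; apply: eq_bigr => i _.
rewrite rmorphXn /= raddf_sum /= mxE; congr (_ ^+ _).
by apply: eq_bigr => j _; rewrite mevalZ mevalXU.
Qed.

Lemma tw_cubic_homog : tw_cubic \is 3.-homog.
Proof.
have hX (k : nat) : ('X_(inord k) : {mpoly K[6]}) \is 1.-homog.
  by rewrite dhomogX; apply/eqP; exact: mdeg1.
have h2 j k : ('X_(inord j) * 'X_(inord k) : {mpoly K[6]}) \is 2.-homog.
  exact: (dhomogM (hX j) (hX k)).
have h3 i j k :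
  ('X_(inord i) * 'X_(inord j) * 'X_(inord k) : {mpoly K[6]}) \is 3.-homog.
  exact: (dhomogM (h2 i j) (hX k)).
rewrite /tw_cubic !exprS !expr0 !mulr1 mulr_natl !mulrA.
by rewrite !(rpredD, rpredN, rpredMn).
Qed.

Lemma omega_twP (L : 'cV[K]_6) :
  (omega_tw^T *m nu3 L) 0 0 = tw_cubic.@[fun i => L i 0].
Proof.
rewrite (meval_homog3 _ tw_cubic_homog) mxE.
by apply: eq_bigr => k _; rewrite !mxE.
Qed.

End Coordinates.

(* Points of P^(n-1) are represented by nonzero column vectors of length n, up
   to [proj_eq]; subsets of P^(n-1) by predicates on such vectors. *)
Section Projective.
Variable K : fieldType.

Definition proj_eq n (u v : 'cV[K]_n) : Prop := exists2 c : K, c != 0 & u = c *: v.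

Definition proj_closed n (Z : 'cV[K]_n -> Prop) : Prop :=
  exists2 I : {mpoly K[n]} -> Prop,
    forall f, I f -> exists d : nat, f \is d.-homog
    & forall v, Z v <-> v != 0 /\ forall f, I f -> f.@[fun i => v i 0] = 0.

Definition proj_open n (U : 'cV[K]_n -> Prop) : Prop :=
  exists2 Z, proj_closed Z & forall v, U v <-> v != 0 /\ ~ Z v.

Definition zariski_closure n (S : 'cV[K]_n -> Prop) (v : 'cV[K]_n) : Prop :=
  v != 0 /\
  forall Z, proj_closed Z -> (forall u, u != 0 -> S u -> Z u) -> Z v.

Definition generically n (P : 'cV[K]_n -> Prop) : Prop :=
  exists U, [/\ proj_open U, exists v, U v & forall v, U v -> P v].

(* f is given by homogeneous polynomials of degree d without a nonconstant
   common factor (in particular not all zero), so d is the degree of the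
   rational map and its domain of definition is the locus f v != 0. *)
Definition rational_map_of_degree n N (d : nat) (f : 'cV[K]_n -> 'cV[K]_N) : Prop :=
  exists F : 'I_N -> {mpoly K[n]},
    [/\ forall k, F k \is d.-homog,
        forall g : {mpoly K[n]},
          (forall k, exists h, F k = g * h) -> exists c : K, g = c%:MP
      & forall v k, f v k 0 = (F k).@[fun i => v i 0]].

Definition in_domain n N (f : 'cV[K]_n -> 'cV[K]_N) (v : 'cV[K]_n) : Prop :=
  v != 0 /\ f v != 0.

Definition rational_image n N (f : 'cV[K]_n -> 'cV[K]_N) (w : 'cV[K]_N) : Prop :=
  exists2 v, in_domain f v & proj_eq w (f v).

Definition maps_into n N (f : 'cV[K]_n -> 'cV[K]_N) (Y : 'cV[K]_N -> Prop) : Prop :=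
  forall v, in_domain f v -> Y (f v).

Definition dominant n N (f : 'cV[K]_n -> 'cV[K]_N) (Y : 'cV[K]_N -> Prop) : Prop :=
  forall w, zariski_closure (rational_image f) w <-> Y w.

Definition fiber_through n N (f : 'cV[K]_n -> 'cV[K]_N) (v v' : 'cV[K]_n) : Prop :=
  in_domain f v' /\ proj_eq (f v') (f v).

Definition has_points n (r : nat) (S : 'cV[K]_n -> Prop) : Prop :=
  exists p : 'I_r -> 'cV[K]_n,
    (forall i j, proj_eq (p i) (p j) -> i = j) /\
    (forall v, S v <-> exists i, proj_eq v (p i)).

Definition generically_to_one n N (r : nat) (f : 'cV[K]_n -> 'cV[K]_N) : Prop :=
  generically (fun v => in_domain f v /\ has_points r (fiber_through f v)).

Definition Ch_tw : 'cV[K]_56 -> Prop :=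
  zariski_closure (fun beta =>
    exists2 M : 'M[K]_4, \rank M = 4%N & proj_eq beta (chow_form M)).

End Projective.

(* Main.v *)
Require Import Defs.
From HB Require Import structures.
From mathcomp Require Import all_boot all_order all_algebra.
From mathcomp Require Import reals complex mpoly ring zify.

(** Read each row of a 4 x 4 matrix M as the coefficients of a binary cubic, so
    that M sends (s^3 : s^2 t : s t^2 : t^3) to a point of a twisted cubic, and
    multiplying M on the right by the symmetric cube [sym3] of an invertible
    2 x 2 matrix g reparametrises that curve by g.  The Chow form of M is the
    cubic form L |-> [tw_eval (dual_wedge2 M *m L)] ([chow_formP]).

    Invariance.  The standard Chow form is the determinant of the Bezout matrix
    of two binary cubics ([tw_eval_bez]), on which g acts by congruence with its
    symmetric square ([bez_sym3]).  Hence the Chow forms of M and of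
    M * sym3 g are proportional ([chow_form_sym3]).

    Recovery.  If N has the Chow form of an invertible M up to a factor, then
    every line through a point of the curve of N meets the curve of M, so
    T = M^-1 N maps the standard twisted cubic into the cone over itself
    ([cone_of_lines]).  The four rows of T are then cubics in geometric
    progression, and unique factorisation of polynomials in one variable forces
    T = h * sym3 g ([sym3_of_cone], [chow_form_fiber]).

    Counting.  Let p and q be the first two rows of M.  The matrices M(m) are
    those with M_00 = 0, M_11 = 0 and M_10 = - M_01.  For M * sym3 g, where g has
    columns v and w, these conditions say that p(v) = 0, that the derivative of q
    at v along w vanishes, and that the derivative of p at v along w is -q(v).
    When v is a simple root of p with q(v) != 0, the last two are a nonsingular
    linear system for w, so w is determined by v.  Up to scaling the
    reparametrisations that preserve the normal form thus correspond to the
    roots of p, which are three for generic m ([has_points_of_roots],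
    [generic_fiber]).

    Dominance.  Conversely, a root of p can be moved to (1 : 0), which gives
    M_00 = 0, and then the construction above at v = (1, 0) reaches the normal
    form as soon as M_01 and M_10 are nonzero.  A closed condition on Chow forms
    that holds off finitely many points of a line of matrices holds on the whole
    line ([chow_form_line]), which removes that restriction
    ([chow_form_closed_iota]); the same principle puts the nonzero Chow forms of
    singular matrices in the closure of those of twisted cubics
    ([chow_form_closed_unit]).

    Degree.  The Chow form scales by c^6 when M scales by c.  Its coefficient at
    L_0^3 depends on the last two rows of M only, and the one at L_5^3 on the
    first two rows only; these involve disjoint sets of variables, so a common
    factor of all coefficients is constant ([iota_tw_degree]). *)

Set Implicit Arguments.
Unset Strict Implicit.
Unset Printing Implicit Defensive.

Import GRing.Theory Num.Theory.
Local Open Scope ring_scope.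

(** * Matrices acting on lines *)

Lemma sum_inord (V : nmodType) n (F : 'I_n.+1 -> V) :
  \sum_(i < n.+1) F i = \sum_(0 <= k < n.+1) F (inord k).
Proof. by rewrite big_mkord; apply: eq_bigr => i _; rewrite inord_val. Qed.

Lemma forall_inord n (P : 'I_n.+1 -> Prop) :
  (forall k, (k < n.+1)%N -> P (inord k)) <-> forall i, P i.
Proof. by split=> [h j | h k _ //]; rewrite -[j]inord_val; apply: h. Qed.

Section Identities.
Variable R : comNzRingType.
Implicit Types (M N : 'M[R]_4) (X Y : 'cV[R]_4) (L : 'cV[R]_6).

Definition tw_eval (L : 'cV[R]_6) : R := (tw_cubic R).@[fun i => L i 0].

Lemma tw_evalE L (l := fun k => L (inord k) 0 : R) :
  tw_eval L = - l 3%N ^+ 3 - l 3%N ^+ 2 * l 2%N + 2%:R * (l 4%N * l 3%N * l 1%N)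
          - l 5%N * l 1%N ^+ 2 - l 4%N ^+ 2 * l 0%N + l 5%N * l 3%N * l 0%N
          + l 5%N * l 2%N * l 0%N.
Proof.
rewrite /tw_eval /tw_cubic.
by rewrite !(mevalD, mevalN, mevalM, mevalXU, meval1) /l; ring.
Qed.

(** The action of [M] on lines read backwards: for invertible [M] it is, up to
    the factor [\det M], the inverse of [wedge2 M]; see [dual_wedge2_plucker]. *)
Definition dual_wedge2 (M : 'M[R]_4) : 'M[R]_6 := Sigma R *m wedge2 M^T *m Sigma R.

Lemma chow_formP M L : ((chow_form M)^T *m nu3 L) 0 0 = tw_eval (dual_wedge2 M *m L).
Proof.
by rewrite /chow_form trmx_mul trmxK -(mulmxA _ _ (nu3 L)) -nu3_mulmx omega_twP.
Qed.

Lemma wedge2M M N : wedge2 (M *m N) = wedge2 M *m wedge2 N.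
Proof.
apply/matrixP => k l.
have E A h : wedge2 A h l = plucker (col (pl_fst l) A) (col (pl_snd l) A) h 0.
  by rewrite !mxE; congr (_ - _); rewrite mulrC.
rewrite E !colE -!mulmxA -wedge2_plucker -!colE.
by rewrite [LHS]mxE [RHS]mxE; apply: eq_bigr => h _; rewrite -E.
Qed.

Lemma SigmaK : Sigma R *m Sigma R = 1%:M.
Proof.
apply/matrixP; apply/forall_inord => i hi; apply/forall_inord => j hj.
rewrite !mxE sum_inord /index_iota /= !big_cons big_nil !mxE !inordK //.
rewrite -val_eqE /= !inordK //.
case: i hi => [|[|[|[|[|[|//]]]]]] _; case: j hj => [|[|[|[|[|[|//]]]]]] _ /=; ring.
Qed.

Lemma dual_wedge2M M N : dual_wedge2 (M *m N) = dual_wedge2 N *m dual_wedge2 M.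
Proof.
rewrite /dual_wedge2 trmx_mul wedge2M !mulmxA; congr (_ *m _).
by rewrite -!mulmxA [X in _ = _ *m (_ *m X)]mulmxA SigmaK mul1mx.
Qed.

Lemma dual_wedge2E M (i j : 'I_6) (s := nth (0 : R) [:: 1; -1; 1; 1; -1; 1])  :
  dual_wedge2 M i j = s i * s j * wedge2 M (rev_ord j) (rev_ord i).
Proof.
have SE (h k : 'I_6) : Sigma R h k = if k == rev_ord h then s h else 0.
  rewrite mxE -val_eqE /=.
  by case: h k => [[|[|[|[|[|[|//]]]]]] ?] [[|[|[|[|[|[|//]]]]]] ?].
rewrite mxE (bigD1 (rev_ord j)) //= big1 ?addr0; last first.
  move=> h nh; rewrite SE ifN ?mulr0 //; apply: contraNneq nh => ->.
  by rewrite rev_ordK.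
rewrite mxE (bigD1 (rev_ord i)) //= big1 ?addr0; last first.
  by move=> h nh; rewrite SE ifN ?mul0r.
rewrite !SE eqxx rev_ordK eqxx.
have -> : s (rev_ord j) = s j.
  by case: j => [[|[|[|[|[|[|//]]]]]] ?].
rewrite [wedge2 _ _ _]mxE [in RHS]mxE !mxE; ring.
Qed.

Lemma dual_wedge2Z c M : dual_wedge2 (c *: M) = c ^+ 2 *: dual_wedge2 M.
Proof. by apply/matrixP => i j; rewrite dual_wedge2E [RHS]mxE dual_wedge2E !mxE; ring. Qed.

Lemma tw_evalZ c L : tw_eval (c *: L) = c ^+ 3 * tw_eval L.
Proof. by rewrite !tw_evalE !mxE; ring. Qed.

Lemma det_mx3 (A : 'M[R]_3) (a := fun i j => A (inord i) (inord j) : R) :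
  \det A = a 0%N 0%N * (a 1%N 1%N * a 2%N 2%N - a 1%N 2%N * a 2%N 1%N)
         - a 0%N 1%N * (a 1%N 0%N * a 2%N 2%N - a 1%N 2%N * a 2%N 0%N)
         + a 0%N 2%N * (a 1%N 0%N * a 2%N 1%N - a 1%N 1%N * a 2%N 0%N).
Proof.
have E (B : 'M[R]_3) : B = \matrix_(i, j) B (inord i) (inord j).
  by apply/matrixP => i j; rewrite mxE !inord_val.
rewrite (expand_det_row _ ord0) !big_ord_recl big_ord0 /cofactor.
rewrite !(expand_det_row _ ord0) !big_ord_recl !big_ord0 /cofactor !det_mx11.
rewrite [A]E !mxE /= /bump /= /a; ring.
Qed.

Lemma adj_mx4 (N : 'M[R]_4) (i j : 'I_4)
    (a := fun h k => N (lift j (inord h)) (lift i (inord k)) : R) :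
  (\adj N) i j = (-1) ^+ (j + i) *
   (a 0%N 0%N * (a 1%N 1%N * a 2%N 2%N - a 1%N 2%N * a 2%N 1%N)
         - a 0%N 1%N * (a 1%N 0%N * a 2%N 2%N - a 1%N 2%N * a 2%N 0%N)
         + a 0%N 2%N * (a 1%N 0%N * a 2%N 1%N - a 1%N 1%N * a 2%N 0%N)).
Proof. by rewrite mxE /cofactor det_mx3 !mxE. Qed.

Lemma lift_inord n (i k : nat) : (i < n.+2)%N -> (k < n.+1)%N ->
  lift (inord i : 'I_n.+2) (inord k : 'I_n.+1) = inord (bump i k).
Proof.
move=> hi hk; apply/val_inj; rewrite /= !inordK //.
by rewrite /bump; case: (i <= k)%N; rewrite ?add1n ?add0n // ltnW.
Qed.

(** The contragredient action brings the line through [M X] and [Y] back to the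
    line through [X] and [M^-1 Y], up to the factor [\det M].  Writing this with
    the adjugate keeps it valid for singular [M], so that singular matrices need
    no separate treatment in [chow_form_fiber]. *)
Lemma dual_wedge2_plucker M X Y :
  dual_wedge2 M *m plucker (M *m X) Y = plucker X (\adj M *m Y).
Proof.
apply/colP; apply/forall_inord => k hk.
rewrite mxE sum_inord /index_iota /= !big_cons big_nil !dual_wedge2E.
rewrite !mxE !sum_inord /index_iota /= !big_cons !big_nil.
rewrite !adj_mx4.
rewrite /pl_fst /pl_snd /=.
case: k hk => [|[|[|[|[|[|//]]]]]] _;
rewrite !inordK // !lift_inord // /=; ring.
Qed.

(** The action of the substitution (s, t) |-> (a s + b t, c s + d t) on the
    monomials of degree 2. *)
Definition sym2 (a b c d : R) : 'M[R]_3 := mx_of_rows 3 3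
  [:: [:: a ^+ 2; 2%:R * a * b; b ^+ 2];
      [:: a * c; a * d + b * c; b * d];
      [:: c ^+ 2; 2%:R * c * d; d ^+ 2]].

(** The action of the same substitution on the monomials of degree 3; see
    [sym3_cubic_pt]. *)
Definition sym3 (a b c d : R) : 'M[R]_4 := mx_of_rows 4 4
  [:: [:: a ^+ 3; 3%:R * a ^+ 2 * b; 3%:R * a * b ^+ 2; b ^+ 3];
      [:: a ^+ 2 * c; a ^+ 2 * d + 2%:R * a * b * c;
          2%:R * a * b * d + b ^+ 2 * c; b ^+ 2 * d];
      [:: a * c ^+ 2; 2%:R * a * c * d + b * c ^+ 2;
          a * d ^+ 2 + 2%:R * b * c * d; b * d ^+ 2];
      [:: c ^+ 3; 3%:R * c ^+ 2 * d; 3%:R * c * d ^+ 2; d ^+ 3]].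

(** When [L] is the wedge of the coefficient vectors of two binary cubics p and
    q, this is the matrix of their Bezoutian (p(x) q(y) - p(y) q(x)) / (x - y).
    It is linear in [L], hence makes sense for all six-dimensional vectors. *)
Definition bez (L : 'cV[R]_6) (l := fun k => L (inord k) 0 : R) : 'M[R]_3 :=
  mx_of_rows 3 3 [:: [:: l 0%N; l 1%N; l 2%N]; [:: l 1%N; l 2%N + l 3%N; l 4%N];
                     [:: l 2%N; l 4%N; l 5%N]].

Lemma tw_eval_bez L : tw_eval L = \det (bez (Sigma R *m L)).
Proof.
rewrite det_mx3 tw_evalE !mxE !inordK // /=.
rewrite !sum_inord /index_iota /= !big_cons !big_nil !mxE !inordK //=; ring.
Qed.

Lemma det_sym2 a b c d : \det (sym2 a b c d) = (a * d - b * c) ^+ 3.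
Proof. by rewrite det_mx3 !mxE !inordK // /=; ring. Qed.

(** The Bezoutian of p o g and q o g is that of p and q at g x and g y; the factor
    a d - b c comes from the denominator, the bracket of g x and g y. *)
Lemma bez_sym3 a b c d L :
  bez (wedge2 (sym3 a b c d)^T *m L) =
  (a * d - b * c) *: ((sym2 a b c d)^T *m bez L *m sym2 a b c d).
Proof.
apply/matrixP; apply/forall_inord => i hi; apply/forall_inord => j hj.
rewrite [LHS]mxE [RHS]mxE [X in _ = _ * X]mxE sum_inord /index_iota /=.
rewrite !big_cons big_nil.
case: i hi => [|[|[|//]]] _; case: j hj => [|[|[|//]]] _;
  rewrite !inordK //= !mxE !sum_inord /index_iota /= !big_cons !big_nil;
  rewrite !mxE /pl_fst /pl_snd !inordK //= ?inordK //=; ring.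
Qed.

Lemma tw_eval_sym3 a b c d L :
  tw_eval (dual_wedge2 (sym3 a b c d) *m L) = (a * d - b * c) ^+ 9 * tw_eval L.
Proof.
rewrite !tw_eval_bez /dual_wedge2 !mulmxA SigmaK mul1mx -mulmxA bez_sym3.
rewrite detZ !det_mulmx det_tr det_sym2; ring.
Qed.

End Identities.

(** * The Chow form as a cubic form, and change of base ring *)

Section BaseChange.
Variables (R S : comNzRingType) (f : {rmorphism R -> S}).

Lemma map_mx_of_rows p q (rows : seq (seq R)) :
  map_mx f (mx_of_rows p q rows) = mx_of_rows p q (map (map f) rows).
Proof.
apply/matrixP => i j; rewrite !mxE.
have [hi|hi] := ltnP i (size rows); last first.
  by rewrite !(nth_default [::]) ?size_map // !nth_nil rmorph0.
rewrite (nth_map [::]) //; set r := nth _ rows i.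
have [hj|hj] := ltnP j (size r); last first.
  by rewrite !nth_default ?size_map // rmorph0.
by rewrite (nth_map 0).
Qed.

Lemma map_wedge2 M : map_mx f (wedge2 M) = wedge2 (map_mx f M).
Proof. by apply/matrixP => k l; rewrite !mxE rmorphB !rmorphM. Qed.

Lemma map_Sigma : map_mx f (Sigma R) = Sigma S.
Proof. by rewrite map_mx_of_rows /= rmorphN !rmorph0 !rmorph1. Qed.

Lemma map_dual_wedge2 M : map_mx f (dual_wedge2 M) = dual_wedge2 (map_mx f M).
Proof. by rewrite /dual_wedge2 !map_mxM map_wedge2 map_Sigma map_trmx. Qed.

Lemma map_tw_eval L : f (tw_eval L) = tw_eval (map_mx f L).
Proof.
rewrite !tw_evalE !mxE.
by rewrite !(rmorphD, rmorphN, rmorphM, rmorphXn, rmorph_nat).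
Qed.

Lemma map_nu3_mx A : map_mx f (nu3_mx A) = nu3_mx (map_mx f A).
Proof.
apply/matrixP => k l; rewrite !mxE -mcoeff_map_mpoly rmorph_prod /=.
congr (_@_ _); apply: eq_bigr => i _; rewrite rmorphXn /= raddf_sum /=.
congr (_ ^+ _); apply: eq_bigr => j _.
by rewrite map_mpolyZ map_mpolyX mxE.
Qed.

Lemma map_omega_tw : map_mx f (omega_tw R) = omega_tw S.
Proof.
apply/colP => k; rewrite !mxE -mcoeff_map_mpoly; congr (_@_ _).
rewrite /tw_cubic.
by rewrite !(rmorphD, rmorphN, rmorphM, rmorphXn, rmorph_nat) /= !map_mpolyX.
Qed.

Lemma map_chow_form M : map_mx f (chow_form M) = chow_form (map_mx f M).
Proof.
by rewrite /chow_form map_mxM -map_trmx map_nu3_mx map_omega_tw map_dual_wedge2.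
Qed.

Lemma map_sym3 a b c d :
  map_mx f (sym3 a b c d) = sym3 (f a) (f b) (f c) (f d).
Proof.
rewrite map_mx_of_rows /=.
by rewrite !(rmorphD, rmorphM, rmorphXn, rmorph_nat).
Qed.

End BaseChange.

Section GenericLine.
Variable R : comNzRingType.
Implicit Types M N : 'M[R]_4.

Local Notation C := (@mpolyC 6 R).

Lemma mon3_inj : injective mon3.
Proof.
move=> k l /eqP; rewrite nth_uniq ?size_basis //; last exact: uniq_basis.
by move/eqP/val_inj.
Qed.

(** A cubic form is determined by its values on the generic vector; letting the
    ring of coordinates vary provides that vector over the polynomial ring. *)
Lemma chow_form_eq M N c :
  (forall (S : comNzRingType) (f : {rmorphism R -> S}) (L : 'cV[S]_6),
     tw_eval (dual_wedge2 (map_mx f M) *m L) =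
     f c * tw_eval (dual_wedge2 (map_mx f N) *m L)) ->
  chow_form M = c *: chow_form N.
Proof.
pose X : 'cV[{mpoly R[6]}]_6 := \col_i 'X_i.
have E (A : 'M[R]_4) (k : 'I_56) :
    (tw_eval (dual_wedge2 (map_mx C A) *m X))@_(mon3 k) = chow_form A k 0.
  have nuX l : nu3 X l 0 = 'X_[mon3 l].
    by rewrite mxE mpolyXE_id; apply: eq_bigr => i _; rewrite mxE.
  rewrite -chow_formP -map_chow_form mxE raddf_sum /= (bigD1 k) //= big1.
    rewrite addr0 nuX [_^T _ _]mxE [map_mx _ _ _ _]mxE.
    by rewrite mcoeffCM mcoeffX eqxx mulr1.
  move=> l nl; rewrite nuX [_^T _ _]mxE [map_mx _ _ _ _]mxE.
  by rewrite mcoeffCM mcoeffX (inj_eq mon3_inj) (negbTE nl) mulr0.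
move=> H; apply/colP => k;
  have := congr1 (mcoeff (mon3 k)) (H _ (C : {rmorphism R -> {mpoly R[6]}}) X).
by rewrite (E M k) mcoeffCM (E N k) => ->; rewrite [RHS]mxE.
Qed.

Lemma chow_formZ c M : chow_form (c *: M) = c ^+ 6 *: chow_form M.
Proof.
apply: chow_form_eq => S f L; rewrite map_mxZ dual_wedge2Z -scalemxAl tw_evalZ.
by rewrite rmorphXn -exprM.
Qed.

Lemma chow_form_sym3 M a b c d :
  chow_form (M *m sym3 a b c d) = (a * d - b * c) ^+ 9 *: chow_form M.
Proof.
apply: chow_form_eq => S f L; rewrite map_mxM map_sym3 dual_wedge2M -mulmxA tw_eval_sym3.
by rewrite rmorphXn rmorphB !rmorphM.
Qed.

End GenericLine.

(** * Chow forms of products and of degenerate matrices *)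

Section ChowFormProducts.
Variable R : comNzRingType.
Implicit Types (M N T : 'M[R]_4) (X Y : 'cV[R]_4) (L : 'cV[R]_6).

Definition vec4 (x y z t : R) : 'cV[R]_4 :=
  \col_i nth 0 [:: x; y; z; t] i.

Definition cubic_pt (s t : R) : 'cV[R]_4 :=
  vec4 (s ^+ 3) (s ^+ 2 * t) (s * t ^+ 2) (t ^+ 3).

Lemma pluckerE X Y k (x := fun i => X (inord i) 0 : R)
    (y := fun i => Y (inord i) 0 : R)
    (i := nth 0%N [:: 0; 0; 0; 1; 1; 2]%N)
    (j := nth 0%N [:: 1; 2; 3; 2; 3; 3]%N) : (k < 6)%N ->
  plucker X Y (inord k) 0 = x (i k) * y (j k) - x (j k) * y (i k).
Proof. by move=> hk; rewrite mxE /pl_fst /pl_snd inordK. Qed.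

Lemma tw_eval_cubic_pt s t Y : tw_eval (plucker (cubic_pt s t) Y) = 0.
Proof. by rewrite tw_evalE !pluckerE //= !mxE !inordK //=; ring. Qed.

Lemma chow_form_eq_eval (S : comNzRingType) (f : {rmorphism R -> S}) T N c
    (L : 'cV[S]_6) :
  chow_form T = c *: chow_form N ->
  tw_eval (dual_wedge2 (map_mx f T) *m L) =
     f c * tw_eval (dual_wedge2 (map_mx f N) *m L).
Proof.
move=> e; rewrite -!chow_formP -!map_chow_form e map_mxZ.
by rewrite linearZ /= -scalemxAl [LHS]mxE.
Qed.

(** Left multiplication by [M] moves both curves by the same projectivity, so
    any comparison of Chow forms can be reduced to the standard cubic. *)
Lemma chow_form_mull M T N c :
  chow_form T = c *: chow_form N -> chow_form (M *m T) = c *: chow_form (M *m N).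
Proof.
move=> e; apply: chow_form_eq => S f L.
rewrite !map_mxM !dual_wedge2M -2!(mulmxA (dual_wedge2 _) (dual_wedge2 _) L).
exact: chow_form_eq_eval.
Qed.

Lemma chow_form_wedge2_eq0 T : wedge2 T = 0 -> chow_form T = 0.
Proof.
move=> w0; rewrite -[RHS](scale0r (chow_form T)); apply: chow_form_eq => S f L.
have -> : dual_wedge2 (map_mx f T) = 0.
  apply/matrixP => i j; rewrite -map_dual_wedge2 mxE dual_wedge2E w0 !mxE mulr0.
  by rewrite rmorph0.
by rewrite mul0mx -(scale0r (0 : 'cV_6)) tw_evalZ expr0n /= rmorph0 !mul0r.
Qed.

Lemma wedge2_rank1 (u : 'cV[R]_4) (v : 'rV[R]_4) : wedge2 (u *m v) = 0.
Proof.
by apply/matrixP => k l; rewrite !mxE !big_ord1; ring.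
Qed.

End ChowFormProducts.

(** * A twisted cubic is determined by its Chow form *)

Section Recognition.
Variable K : numClosedFieldType.
Implicit Types (M T : 'M[K]_4) (x y : 'cV[K]_4).

Lemma poly_fun_eq0 (p : {poly K}) : (forall t, p.[t] = 0) -> p = 0.
Proof.
move=> p0; apply/eqP; apply: contraT => nz.
pose s := [seq n%:R : K | n <- iota 0 (size p)].
have us : uniq s by rewrite map_inj_uniq ?iota_uniq //; exact: mulrIn (oner_neq0 _).
have := max_poly_roots nz _ us.
rewrite size_map size_iota ltnn; apply; apply/allP => a _.
by rewrite rootE p0.
Qed.

Lemma chow_form1 : chow_form (1%:M : 'M[K]_4) != 0.
Proof.
apply/eqP => h0; pose L : 'cV[K]_6 := \col_i nth 0 [:: 1; 0; 0; 0; 1; 0] i.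
have := chow_formP 1%:M L; rewrite h0 trmx0 mul0mx mxE => /esym.
have -> : dual_wedge2 (1%:M : 'M[K]_4) = 1%:M.
  have e : wedge2 (1%:M : 'M[K]_4)^T = 1%:M.
    rewrite trmx1; apply/matrixP; apply/forall_inord => i hi.
    apply/forall_inord => j hj.
    rewrite !mxE /pl_fst /pl_snd -!val_eqE.
    case: i hi => [|[|[|[|[|[|//]]]]]] _;
      case: j hj => [|[|[|[|[|[|//]]]]]] _; rewrite /= !inordK //=; ring.
   by rewrite /dual_wedge2 e mulmx1 SigmaK.
rewrite mul1mx tw_evalE !mxE !inordK //=.
rewrite !(expr0n, expr1n, mulr0, mul0r, mulr1, mul1r, oppr0, addr0, add0r).
by move/eqP; rewrite oppr_eq0 oner_eq0.
Qed.

(** A point all of whose lines meet the standard twisted cubic is on it.  The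
    lines towards the coordinate points give two cubic equations and settle the
    case [c 0 = 0].  Otherwise the lines are tested against the second and the
    first derivative of the curve at the parameter [u = c 1 / c 0]: they yield
    u r = 0 and r^3 = 9 (u r)^2 for the defect [r] of [c 2]. *)
Lemma cone_of_lines x (c := fun i => x (inord i) 0 : K) :
  (forall y, tw_eval (plucker x y) = 0) ->
  [/\ c 0%N * c 2%N = c 1%N ^+ 2, c 1%N * c 3%N = c 2%N ^+ 2 & c 0%N * c 3%N = c 1%N * c 2%N].
Proof.
move=> tw0.
have tw (p q r t : K) : tw_eval (plucker x (vec4 p q r t)) = 0 by exact: tw0.
have cube0 (z : K) : z ^+ 3 = 0 -> z = 0.
  by move/eqP; rewrite expf_eq0 => /eqP.
have e1 : c 2%N ^+ 3 = c 3%N ^+ 2 * c 0%N.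
  apply/eqP; rewrite -subr_eq0 -(tw 0 1 0 0) tw_evalE !pluckerE //= !mxE !inordK //=.
  by rewrite /c; apply/eqP; ring.
have e2 : c 1%N ^+ 3 = c 3%N * c 0%N ^+ 2.
  apply/eqP; rewrite -subr_eq0 -oppr_eq0 -(tw 0 0 1 0).
  rewrite tw_evalE !pluckerE //= !mxE !inordK //=.
  by rewrite /c; apply/eqP; ring.
have [c0|c0] := eqVneq (c 0%N) 0.
  have c1 : c 1%N = 0.
    by apply: cube0; rewrite e2 c0 expr0n mulr0.
  have c2 : c 2%N = 0.
    by apply: cube0; rewrite e1 c0 mulr0.
  by rewrite c0 c1 c2 !(mul0r, expr0n).
have c03 : c 0%N ^+ 3 != 0 by rewrite expf_neq0.
(* [u] is the parameter of the only point of the curve with these [c 0], [c 1]. *)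
pose u := c 1%N / c 0%N; pose r := c 2%N / c 0%N - u ^+ 2.
have h1 : c 1%N = c 0%N * u by rewrite /u; field.
have h2 : c 2%N = c 0%N * (r + u ^+ 2) by rewrite /r; field.
have h3 : c 3%N = c 0%N * u ^+ 3.
  by apply: (mulIf (expf_neq0 2 c0)); rewrite -e2 h1; ring.
have ur : u * r = 0.
  (* Half the second derivative of (1, u, u^2, u^3). *)
  have := tw 0 0 1 (3%:R * u).
  rewrite tw_evalE !pluckerE //= -/(c 0%N) -/(c 1%N) -/(c 2%N) -/(c 3%N).
  rewrite h1 h2 h3 !mxE !inordK //= => e.
  have : c 0%N ^+ 3 * (3%:R * (u * r)) = 0.
    by rewrite -oppr0 -[in RHS]e; ring.
  by move/eqP; rewrite mulf_eq0 (negbTE c03) mulf_eq0 pnatr_eq0 => /eqP.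
have r0 : r = 0.
  (* The first derivative of (1, u, u^2, u^3). *)
  have := tw 0 1 (2%:R * u) (3%:R * u ^+ 2).
  rewrite tw_evalE !pluckerE //= -/(c 0%N) -/(c 1%N) -/(c 2%N) -/(c 3%N).
  rewrite h1 h2 h3 !mxE !inordK //= => e.
  have : c 0%N ^+ 3 * (r ^+ 3 - 9%:R * (u * r) ^+ 2) = 0.
    by rewrite -[in RHS]e; ring.
  move/eqP; rewrite ur expr0n /= mulr0 subr0 mulf_eq0 (negbTE c03).
  by move/eqP/cube0.
by rewrite h1 h2 h3 r0; split; ring.
Qed.

End Recognition.

Lemma sym3_cubic_pt (R : comNzRingType) (a b c d s t : R) :
  sym3 a b c d *m cubic_pt s t = cubic_pt (a * s + b * t) (c * s + d * t).
Proof.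
apply/colP; apply/forall_inord => i hi.
rewrite mxE sum_inord /index_iota /= !big_cons big_nil !mxE !inordK //.
by case: i hi => [|[|[|[|//]]]] _ /=; ring.
Qed.

Section ReparametrisationOfCone.
Variable K : numClosedFieldType.
Implicit Types (M T : 'M[K]_4).

(** The ratio f1 / f0 = b / a in lowest terms is also f2 / f1 and f3 / f2, so
    that a^3 divides f0. *)
Lemma twisted_cubic_factor (F : fieldType) (f0 f1 f2 f3 : {poly F}) :
  f0 != 0 -> f0 * f2 = f1 ^+ 2 -> f0 * f3 = f1 * f2 ->
  exists a b h, [/\ f0 = a ^+ 3 * h, f1 = a ^+ 2 * b * h,
                    f2 = a * b ^+ 2 * h & f3 = b ^+ 3 * h].
Proof.
move=> nz0 e02 e03; pose d := gcdp f0 f1.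
have nzd : d != 0 by rewrite gcdp_eq0 negb_and nz0.
have /dvdpP [a ea] : d %| f0 by exact: dvdp_gcdl.
have /dvdpP [b eb] : d %| f1 by exact: dvdp_gcdr.
have cab : coprimep a b.
  have := @coprimep_div_gcd _ f0 f1; rewrite nz0 => /(_ isT).
  by rewrite -/d ea eb !mulpK.
have nza : a != 0 by apply: contraNneq nz0 => a0; rewrite ea a0 mul0r.
have e2 : a * f2 = b ^+ 2 * d.
  by apply: (mulfI nzd); move: e02; rewrite ea eb => e; rewrite mulrA [d * a]mulrC e; ring.
have /dvdpP [e ed] : a %| d.
  rewrite -(Gauss_dvdpr d (_ : coprimep a (b ^+ 2))) ?coprimepX //.
    by rewrite -e2 dvdp_mulIl.
  exact: coprimep_expr.
have e2' : f2 = b ^+ 2 * e.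
  by apply: (mulfI nza); rewrite e2 ed; ring.
have e3 : a * f3 = b ^+ 3 * e.
  by apply: (mulfI nzd); rewrite mulrA [d * a]mulrC -ea e03 eb e2'; ring.
have /dvdpP [h eh] : a %| e.
  rewrite -(Gauss_dvdpr e (_ : coprimep a (b ^+ 3))).
    by rewrite -e3 dvdp_mulIl.
  exact: coprimep_expr.
exists a, b, h; split.
- by rewrite ea ed eh; ring.
- by rewrite eb ed eh; ring.
- by rewrite e2' eh; ring.
by apply: (mulfI nza); rewrite e3 eh; ring.
Qed.

Lemma mulmx_cubic_pt_inj m (A B : 'M[K]_(m, 4)) :
  (forall t, A *m cubic_pt 1 t = B *m cubic_pt 1 t) -> A = B.
Proof.
move=> h; apply/matrixP => i; apply/forall_inord => j hj.
pose p := \poly_(k < 4) (A i (inord k) - B i (inord k)).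
have p0 : p = 0.
  apply: poly_fun_eq0 => t; rewrite horner_poly.
  have := congr1 (fun u : 'cV_m => u i 0) (h t); rewrite !mxE.
  move/eqP; rewrite -subr_eq0 -sumrB => /eqP e; rewrite -[RHS]e.
  apply: eq_bigr => k _.
  rewrite inord_val mulrBl !mxE.
  by case: k => [[|[|[|[|//]]]] ?] /=; rewrite ?(expr1n, mul1r, mulr1, expr0, expr1).
by apply/eqP; rewrite -subr_eq0; have := coef0 K j; rewrite -p0 coef_poly hj => ->.
Qed.

Definition row_poly (T : 'M[K]_4) (i : nat) : {poly K} :=
  \poly_(k < 4) T (inord i) (inord k).

Lemma horner_row_poly T i t :
  (row_poly T i).[t] = (T *m cubic_pt 1 t) (inord i) 0.
Proof.
rewrite horner_poly !mxE; apply: eq_bigr => k _; rewrite inord_val !mxE.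
by case: k => [[|[|[|[|//]]]] ?] /=; rewrite ?(expr1n, mul1r, mulr1, expr0, expr1).
Qed.

Lemma chow_form_rank1 T (k : nat -> K) (v : 'rV[K]_4) :
  (forall i t, (i < 4)%N -> (row_poly T i).[t] = k i * (v *m cubic_pt 1 t) 0 0) ->
  chow_form T = 0.
Proof.
move=> h; suff -> : T = (\col_i k i) *m v.
  by apply: chow_form_wedge2_eq0; exact: wedge2_rank1.
apply: mulmx_cubic_pt_inj => t; apply/colP; apply/forall_inord => i hi.
by rewrite -horner_row_poly h // -mulmxA [RHS]mxE big_ord1 [X in _ = X * _]mxE inordK.
Qed.

Lemma row_poly0 T t : (row_poly T 0).[t] = (row (inord 0) T *m cubic_pt 1 t) 0 0.
Proof. by rewrite horner_row_poly -row_mul [RHS]mxE. Qed.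

Lemma size_cubeM (a h : {poly K}) :
  h != 0 -> (size (a ^+ 3 * h)%R <= 4)%N -> (1 < size a)%N ->
  (size a <= 2)%N /\ (size h <= 1)%N.
Proof.
move=> nzh sz sa; have nza : a != 0 by rewrite -size_poly_gt0 ltnW.
have nz3 : a ^+ 3 != 0 by rewrite expf_neq0.
move: sz; rewrite size_mul // => sz; have := size_exp a 3.
move: nz3 nzh sa sz; rewrite -!size_poly_gt0.
by move: (size a) (size h) (size (a ^+ 3)) => x y z; lia.
Qed.

(** The rows of [T] are cubic polynomials a^3 h, a^2 b h, a b^2 h, b^3 h by
    [twisted_cubic_factor].  Were a and b both constant, [T] would have rank one
    and a zero Chow form; so one of them has degree one, and then h is constant
    for degree reasons. *)
Lemma sym3_of_cone T :
  (forall t, let c i := (T *m cubic_pt 1 t) (inord i) 0 in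
     [/\ c 0%N * c 2%N = c 1%N ^+ 2, c 1%N * c 3%N = c 2%N ^+ 2 & c 0%N * c 3%N = c 1%N * c 2%N]) ->
  chow_form T != 0 ->
  exists h a b c d, [/\ h != 0, a * d - b * c != 0 & T = h *: sym3 a b c d].
Proof.
move=> cone nzT; pose f := row_poly T.
(* The cone equations hold at all values, hence between the polynomials. *)
have e02 : f 0%N * f 2%N = f 1%N ^+ 2.
  apply/eqP; rewrite -subr_eq0; apply/eqP/poly_fun_eq0 => t.
  by rewrite !hornerE !horner_row_poly; case: (cone t) => -> _ _; rewrite subrr.
have e13 : f 1%N * f 3%N = f 2%N ^+ 2.
  apply/eqP; rewrite -subr_eq0; apply/eqP/poly_fun_eq0 => t.
  by rewrite !hornerE !horner_row_poly; case: (cone t) => _ -> _; rewrite subrr.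
have e03 : f 0%N * f 3%N = f 1%N * f 2%N.
  apply/eqP; rewrite -subr_eq0; apply/eqP/poly_fun_eq0 => t.
  by rewrite !hornerE !horner_row_poly; case: (cone t) => _ _ ->; rewrite subrr.
have nz0 : f 0%N != 0.
  apply: contraNneq nzT => f0.
  have f1 : f 1%N = 0 by apply/eqP; rewrite -sqrf_eq0 -e02 f0 mul0r.
  have f2 : f 2%N = 0 by apply/eqP; rewrite -sqrf_eq0 -e13 f1 mul0r.
  apply/eqP; apply: (@chow_form_rank1 T (fun i => (i == 3)%:R) (row (inord 3) T)).
  move=> i t; case: i => [|[|[|[|//]]]] _ /=;
    rewrite -/(f _) ?f0 ?f1 ?f2 ?horner0 ?mul0r //.
  by rewrite mul1r horner_row_poly -row_mul [RHS]mxE.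
have [a [b [h [E0 E1 E2 E3]]]] := twisted_cubic_factor nz0 e02 e03.
have sf i : (size (f i) <= 4)%N by exact: size_poly.
have nzh : h != 0 by apply: contraNneq nz0 => h0; rewrite E0 h0 mulr0.
have [sh sa sb] : [/\ size h <= 1, size a <= 2 & size b <= 2]%N.
  have [sa|sa] := leqP (size a) 1; last first.
    have [sa2 sh] : (size a <= 2)%N /\ (size h <= 1)%N.
      by apply: size_cubeM => //; rewrite -E0.
    split=> //; have [sb|sb] := leqP (size b) 1; first exact: leqW.
    by have [] : (size b <= 2)%N /\ (size h <= 1)%N by apply: size_cubeM; rewrite // -E3.
  have [sb|sb] := leqP (size b) 1; last first.
    have [sb2 sh] : (size b <= 2)%N /\ (size h <= 1)%N.
      by apply: size_cubeM => //; rewrite -E3.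
    by split=> //; exact: leqW.
  case/eqP: nzT; have := size1_polyC sa; have := size1_polyC sb.
  set a0 := a`_0; set b0 := b`_0 => eb ea.
  have nza0 : a0 != 0.
    by apply: contraNneq nz0 => a00; rewrite E0 ea a00 polyC0 expr0n mul0r.
  apply: (@chow_form_rank1 T (fun i => (b0 / a0) ^+ i) (row (inord 0) T)) => i t hi.
  rewrite -row_poly0 -/(f 0%N) -/(f i); case: i hi => [|[|[|[|//]]]] _;
    rewrite ?E0 ?E1 ?E2 ?E3 ?ea ?eb !(hornerM, horner_exp, hornerC); field; exact: nza0.
have eh := size1_polyC sh.
exists h`_0, a`_0, a`_1, b`_0, b`_1.
have ET : T = h`_0 *: sym3 a`_0 a`_1 b`_0 b`_1.
  apply: mulmx_cubic_pt_inj => t; rewrite -scalemxAl sym3_cubic_pt.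
  have ha : a.[t] = a`_0 * 1 + a`_1 * t.
    rewrite (@horner_coef_wide _ 2) // !big_ord_recl big_ord0 /= expr0 expr1 addr0.
    by [].
  have hb : b.[t] = b`_0 * 1 + b`_1 * t.
    rewrite (@horner_coef_wide _ 2) // !big_ord_recl big_ord0 /= expr0 expr1 addr0.
    by [].
  have hh : h.[t] = h`_0 by rewrite eh hornerC coefC.
  rewrite -ha -hb -hh; apply/colP; apply/forall_inord => i hi.
  rewrite -horner_row_poly -/(f i) !mxE inordK //.
  by case: i hi => [|[|[|[|//]]]] _ /=; rewrite ?E0 ?E1 ?E2 ?E3 !(hornerM, horner_exp); ring.
split=> //.
  by apply: contraNneq nzh => h0; rewrite eh h0.
apply: contraNneq nzT => d0.
by rewrite ET -[sym3 _ _ _ _]mul1mx chow_formZ chow_form_sym3 d0 expr0n /= scale0r scaler0.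
Qed.

(** The Chow form of a twisted cubic determines the curve, and a matrix is
    determined by the curve up to a reparametrisation and a scalar. *)
Lemma chow_form_fiber M N : M \in unitmx -> proj_eq (chow_form N) (chow_form M) ->
  exists h a b c d, [/\ h != 0, a * d - b * c != 0 &
                        N = h *: (M *m sym3 a b c d)].
Proof.
move=> uM [k nzk eNM]; pose T := invmx M *m N.
have eT : chow_form T = k *: chow_form (1%:M : 'M[K]_4).
  by rewrite -(mulVmx uM); exact: chow_form_mull.
have [||h [a [b [c [d [nzh nzd ET]]]]]] := @sym3_of_cone T.
- move=> t; apply: cone_of_lines => Y.
  have e := dual_wedge2_plucker T (cubic_pt 1 t) Y.
  have := chow_form_eq_eval idfun (plucker (T *m cubic_pt 1 t) Y) eT.
  rewrite !map_mx_id // e tw_eval_cubic_pt => /esym/eqP.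
  rewrite mulf_eq0 (negbTE nzk) /= => /eqP.
  have e1 := dual_wedge2_plucker (1%:M : 'M[K]_4) (T *m cubic_pt 1 t) Y.
  by rewrite mul1mx in e1; rewrite e1 adj1 mul1mx.
- by rewrite eT scaler_eq0 negb_or nzk chow_form1.
exists h, a, b, c, d; split=> //.
by rewrite scalemxAr -ET mulmxA mulmxV // mul1mx.
Qed.

End ReparametrisationOfCone.

(** * Reparametrisation to the normal form *)

Section NormalForm.
Variable R : comNzRingType.
Implicit Types (M N : 'M[R]_4) (m : 'cV[R]_13).

Definition row_cubic M (i j : nat) : R := M (inord i) (inord j).

Definition cub (u : nat -> R) (s t : R) : R :=
  u 0%N * s ^+ 3 + u 1%N * s ^+ 2 * t + u 2%N * s * t ^+ 2 + u 3%N * t ^+ 3.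
Definition cub_ds (u : nat -> R) (s t : R) : R :=
  3%:R * u 0%N * s ^+ 2 + 2%:R * u 1%N * s * t + u 2%N * t ^+ 2.
Definition cub_dt (u : nat -> R) (s t : R) : R :=
  u 1%N * s ^+ 2 + 2%:R * u 2%N * s * t + 3%:R * u 3%N * t ^+ 2.
Definition jac (u v : nat -> R) (s t : R) : R :=
  cub_ds v s t * cub_dt u s t - cub_dt v s t * cub_ds u s t.

Lemma mul_sym3_col0 M i a b c d :
  row_cubic (M *m sym3 a b c d) i 0 = cub (row_cubic M i) a c.
Proof.
rewrite /row_cubic mxE sum_inord /index_iota /= !big_cons big_nil !mxE !inordK //=.
by rewrite /cub; ring.
Qed.

Lemma mul_sym3_col1 M i a b c d :
  row_cubic (M *m sym3 a b c d) i 1 =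
  b * cub_ds (row_cubic M i) a c + d * cub_dt (row_cubic M i) a c.
Proof.
rewrite /row_cubic mxE sum_inord /index_iota /= !big_cons big_nil !mxE !inordK //=.
by rewrite /cub_ds /cub_dt; ring.
Qed.

Definition normal_form M : Prop :=
  [/\ row_cubic M 0 0 = 0, row_cubic M 1 1 = 0 & row_cubic M 1 0 = - row_cubic M 0 1].

Definition unMmx M : 'cV[R]_13 :=
  \col_k row_cubic M (nth 0 [:: 0; 0; 0; 1; 1; 2; 2; 2; 2; 3; 3; 3; 3] k)%N
                  (nth 0 [:: 1; 2; 3; 2; 3; 0; 1; 2; 3; 0; 1; 2; 3] k)%N.

Lemma MmxK m : unMmx (Mmx m) = m.
Proof.
apply/colP; apply/forall_inord => k hk; rewrite mxE /row_cubic inordK // mxE.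
by do 13?[case: k hk => [|k] hk //=; first by rewrite !inordK].
Qed.

Lemma unMmxK M : normal_form M -> Mmx (unMmx M) = M.
Proof.
case=> h0 h1 h2; apply/matrixP; apply/forall_inord => i hi.
apply/forall_inord => j hj; rewrite mxE !inordK //.
case: i hi => [|[|[|[|//]]]] _; case: j hj => [|[|[|[|//]]]] _ /=;
  by rewrite ?mxE ?inordK //= -?h0 -?h1 -?h2.
Qed.

Lemma Mmx_normal m : normal_form (Mmx m).
Proof. by split; rewrite /row_cubic !mxE !inordK //=. Qed.

Lemma unMmxZ c M : unMmx (c *: M) = c *: unMmx M.
Proof. by apply/colP => k; rewrite !mxE /row_cubic mxE. Qed.

Lemma MmxZ c m : Mmx (c *: m) = c *: Mmx m.
Proof.
rewrite -[m in RHS]MmxK -[RHS]unMmxK; last first.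
  by rewrite MmxK; split; rewrite /row_cubic !mxE !inordK //=; ring.
by rewrite unMmxZ !MmxK.
Qed.

(** The substitution, with first column proportional to (s, t), that brings [M] to
    normal form when (s, t) is a root of the first row p: its second column
    solves the linear system for w, by Cramer's rule with determinant [jac], and
    the denominators have been cleared. *)
Definition adapt M (s t : R) : 'M[R]_4 :=
  let p := row_cubic M 0 in let q := row_cubic M 1 in
  sym3 (jac p q s t * s) (cub q s t * cub_dt q s t)
       (jac p q s t * t) (- (cub q s t * cub_ds q s t)).

Lemma cubZ u k s t : cub u (k * s) (k * t) = k ^+ 3 * cub u s t.
Proof. by rewrite /cub; ring. Qed.
Lemma cub_dsZ u k s t : cub_ds u (k * s) (k * t) = k ^+ 2 * cub_ds u s t.
Proof. by rewrite /cub_ds; ring. Qed.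
Lemma cub_dtZ u k s t : cub_dt u (k * s) (k * t) = k ^+ 2 * cub_dt u s t.
Proof. by rewrite /cub_dt; ring. Qed.
Lemma jacZ u v k s t : jac u v (k * s) (k * t) = k ^+ 4 * jac u v s t.
Proof. by rewrite /jac !cub_dsZ !cub_dtZ; ring. Qed.

Lemma euler_cub u s t : s * cub_ds u s t + t * cub_dt u s t = 3%:R * cub u s t.
Proof. by rewrite /cub /cub_ds /cub_dt; ring. Qed.

Lemma sym3Z (k a b c d : R) : sym3 (k * a) (k * b) (k * c) (k * d) = k ^+ 3 *: sym3 a b c d.
Proof.
apply/matrixP; apply/forall_inord => i hi; apply/forall_inord => j hj.
rewrite !mxE !inordK //.
by case: i hi => [|[|[|[|//]]]] _; case: j hj => [|[|[|[|//]]]] _ /=; ring.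
Qed.

Lemma adaptZ M k s t : adapt M (k * s) (k * t) = (k ^+ 5) ^+ 3 *: adapt M s t.
Proof.
by rewrite /adapt -sym3Z jacZ !cubZ cub_dsZ cub_dtZ; congr (sym3 _ _ _ _); ring.
Qed.

Lemma adapt_normal M s t : cub (row_cubic M 0) s t = 0 ->
  normal_form (M *m adapt M s t).
Proof.
move=> p0; split.
- by rewrite mul_sym3_col0 cubZ p0 mulr0.
- by rewrite mul_sym3_col1 cub_dsZ cub_dtZ; ring.
by rewrite mul_sym3_col0 mul_sym3_col1 !cubZ cub_dsZ cub_dtZ /jac; ring.
Qed.

Lemma chow_form_adapt M N s t (p := row_cubic M 0) (q := row_cubic M 1) :
  chow_form (N *m adapt M s t) =
  (- (3%:R * jac p q s t * cub q s t ^+ 2)) ^+ 9 *: chow_form N.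
Proof.
rewrite chow_form_sym3; congr (_ ^+ 9 *: _); rewrite -/p -/q.
have -> : 3%:R * jac p q s t * cub q s t ^+ 2 =
          jac p q s t * cub q s t * (3%:R * cub q s t) by ring.
by rewrite -euler_cub; ring.
Qed.

End NormalForm.

Section Fiber.
Variable F : fieldType.
Implicit Types (M : 'M[F]_4).

(** The linear system for the second column has a unique solution where the
    Jacobian of p and q does not vanish. *)
Lemma normal_form_adapt M a b c d (p := row_cubic M 0) (q := row_cubic M 1) :
  jac p q a c != 0 -> normal_form (M *m sym3 a b c d) ->
  sym3 a b c d = (jac p q a c) ^- 3 *: adapt M a c.
Proof.
move=> nzJ [_]; rewrite !mul_sym3_col0 !mul_sym3_col1 -/p -/q => e1 e2.
rewrite -exprVn -sym3Z -/p -/q !mulrA mulVf // !mul1r.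
have eb : b = (jac p q a c)^-1 * (cub q a c * cub_dt q a c).
  apply: (mulfI nzJ); rewrite !mulrA mulfV // mul1r e2 {1}/jac.
  rewrite -[RHS]addr0 -[in RHS](mulr0 (cub_dt p a c)) -e1; ring.
have ed : d = (jac p q a c)^-1 * - (cub q a c * cub_ds q a c).
  apply: (mulfI nzJ); rewrite !mulrA mulfV // mul1r e2 {1}/jac.
  rewrite -[RHS]addr0 -[in RHS](mulr0 (- cub_ds p a c)) -e1; ring.
by rewrite {1}eb {1}ed !mulrA.
Qed.

End Fiber.

(** * Counting the points of a generic fiber *)

(** With p = t (c0 s^2 + c1 s t + c2 t^2) and q = - c0 s^3 + c3 s t^2 + c4 t^3 the
    first two rows of [Mmx m], the factors are: c0, the value of p / t and of -q at
    the root (1 : 0); the discriminant of p / t; the resultant of p / t with the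
    remainder al s + be t of c0 q modulo p / t; and the determinant of [Mmx m].
    Its nonvanishing makes the three roots of p distinct and keeps them away from
    the roots of q. *)
Definition genericity (R : comNzRingType) (m : 'cV[R]_13)
    (c := fun k => m (inord k) 0 : R)
    (al := c 0%N * (c 2%N + c 3%N) - c 1%N ^+ 2)
    (be := c 0%N * c 4%N - c 1%N * c 2%N) : R :=
  c 0%N * (c 1%N ^+ 2 - 4%:R * c 0%N * c 2%N)
  * (c 0%N * be ^+ 2 - c 1%N * al * be + c 2%N * al ^+ 2) * \det (Mmx m).

Section Count.
Variable K : numClosedFieldType.
Implicit Types (M : 'M[K]_4) (m : 'cV[K]_13).

(** The first column of [adapt M s t] is a multiple of the point of the twisted
    cubic with parameter (s : t), which determines that parameter. *)
Lemma adapt_inj M s t s' t' c (p := row_cubic M 0) (q := row_cubic M 1) :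
  jac p q s t != 0 -> jac p q s' t' != 0 ->
  adapt M s t = c *: adapt M s' t' -> s * t' = s' * t.
Proof.
move=> nzJ nzJ' e.
have E k := congr1 (fun A : 'M[K]_4 => row_cubic A k 0) e.
have e0 := E 0%N; have e1 := E 1%N; have e2 := E 2%N; have e3 := E 3%N.
move: e0 e1 e2 e3; rewrite /adapt -/p -/q /row_cubic !mxE !inordK //=.
set x := _ * s; set y := _ * t; set x' := _ * s'; set y' := _ * t'.
move=> e0 e1 e2 e3.
have : (x * y' - x' * y) ^+ 3 = 0.
  (* The cube of the bracket is bilinear in the two points of the twisted cubic. *)
  transitivity (x ^+ 3 * y' ^+ 3 - 3%:R * (x ^+ 2 * y) * y' ^+ 2 * x'
    + 3%:R * (x * y ^+ 2) * y' * x' ^+ 2 - y ^+ 3 * x' ^+ 3); first by ring.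
  by rewrite e0 e1 e2 e3; ring.
move/eqP; rewrite expf_eq0 /= subr_eq0 => /eqP.
have -> : x * y' = jac p q s t * jac p q s' t' * (s * t') by rewrite /x /y'; ring.
have -> : x' * y = jac p q s t * jac p q s' t' * (s' * t) by rewrite /x' /y; ring.
by apply: mulfI; rewrite mulf_neq0.
Qed.

Lemma iota_twZ c m : iota_tw (c *: m) = c ^+ 6 *: iota_tw m.
Proof. by rewrite /iota_tw MmxZ chow_formZ. Qed.

Lemma iota_tw_domain m : iota_tw m != 0 -> in_domain (@iota_tw K) m.
Proof.
move=> nz; split=> //; apply: contraNneq nz => ->.
by rewrite -(scale0r (0 : 'cV_13)) iota_twZ expr0n /= scale0r.
Qed.

Lemma chow_form_unit M : M \in unitmx -> chow_form M != 0.
Proof.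
move=> uM; apply: contraNneq (chow_form1 K) => h0.
rewrite -(mulVmx uM); apply/eqP.
transitivity (0 *: chow_form (invmx M *m M)); last by rewrite scale0r.
by apply: chow_form_mull; rewrite h0 scale0r.
Qed.

(** The points of the fiber through [m] are read off from [M *m adapt M v], for v
    among the three roots of p. *)
Lemma has_points_of_roots m (M := Mmx m) (p := row_cubic M 0) (q := row_cubic M 1)
    (s t : 'I_3 -> K) :
  M \in unitmx ->
  (forall i, cub p (s i) (t i) = 0) ->
  (forall i, cub q (s i) (t i) != 0) ->
  (forall i, jac p q (s i) (t i) != 0) ->
  (forall i j, s i * t j = s j * t i -> i = j) ->
  (forall a c, cub p a c = 0 -> (a, c) != (0, 0) ->
     exists i k, a = k * s i /\ c = k * t i) ->
  has_points 3 (fiber_through (@iota_tw K) m).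
Proof.
move=> uM p0 nzq nzJ inj all.
pose P i := unMmx (M *m adapt M (s i) (t i)).
have MP i : Mmx (P i) = M *m adapt M (s i) (t i).
  by rewrite unMmxK //; exact: adapt_normal.
exists P; split.
  move=> i j [c nzc e]; apply: inj; apply: (@adapt_inj M _ _ _ _ c) => //.
  have := congr1 (@Mmx K) e; rewrite MmxZ !MP scalemxAr => /(congr1 (mulmx (invmx M))).
  by rewrite !mulmxA mulVmx // !mul1mx.
move=> v; split.
  case=> [[nzv nziv] ev].
  have [h [a [b [c [d [nzh nzd eN]]]]]] := chow_form_fiber uM ev.
  have nf : normal_form (M *m sym3 a b c d).
    have -> : M *m sym3 a b c d = Mmx (h^-1 *: v).
      by rewrite MmxZ eN scalerA mulVf // scale1r.
    exact: Mmx_normal.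
  have [||i [k [ea ec]]] := all a c.
  - by case: nf => + _ _; rewrite mul_sym3_col0.
  - by apply: contraNneq nzd => -[-> ->]; rewrite mul0r mulr0 subrr.
  have nzk : k != 0.
    by apply: contraNneq nzd => k0; rewrite ea ec k0 !mul0r mulr0 subrr.
  have nzJk : jac p q a c != 0.
    by rewrite ea ec jacZ mulf_neq0 // expf_neq0.
  have eS := normal_form_adapt nzJk nf.
  rewrite -/p -/q {3}ea {3}ec adaptZ scalerA in eS.
  exists i, (h * ((jac p q a c) ^- 3 * (k ^+ 5) ^+ 3)).
    by rewrite !mulf_neq0 // ?invr_eq0 ?expf_neq0.
  by rewrite -[v]MmxK eN eS -scalemxAr scalerA unMmxZ.
case=> i [k nzk ->].
have eP : iota_tw (k *: P i) = k ^+ 6 *: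
    ((- (3%:R * jac p q (s i) (t i) * cub q (s i) (t i) ^+ 2)) ^+ 9 *: iota_tw m).
  by rewrite iota_twZ /iota_tw MP chow_form_adapt.
have nzc : k ^+ 6 * (- (3%:R * jac p q (s i) (t i) * cub q (s i) (t i) ^+ 2)) ^+ 9 != 0.
  by rewrite mulf_neq0 ?expf_neq0 // oppr_eq0 !mulf_neq0 ?pnatr_eq0 ?expf_neq0.
split; last by eexists; [exact: nzc | rewrite eP scalerA].
apply: iota_tw_domain; rewrite eP scalerA scaler_eq0 negb_or nzc.
exact: chow_form_unit.
Qed.

(** The roots of p are (1 : 0) and (r1 : 1), (r2 : 1), where r1 and r2 are the roots
    of the quadratic factor.  Euler's identity reduces the Jacobian at a root of
    p to the product of q and of a partial derivative of p. *)
Lemma generic_fiber m : genericity m != 0 ->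
  in_domain (@iota_tw K) m /\ has_points 3 (fiber_through (@iota_tw K) m).
Proof.
pose c k : K := m (inord k) 0.
rewrite /genericity -/(c 0%N) -/(c 1%N) -/(c 2%N) -/(c 3%N) -/(c 4%N).
set al := _ - c 1%N ^+ 2; set be := _ - c 1%N * c 2%N.
rewrite !mulf_eq0 !negb_or -!andbA => /and4P [nz0 nzd nzr nzdet].
have uM : Mmx m \in unitmx by rewrite unitmxE unitfE.
split; first by apply: iota_tw_domain; exact: chow_form_unit.
set p := row_cubic (Mmx m) 0; set q := row_cubic (Mmx m) 1.
have [p0 p1 p2 p3] : [/\ p 0%N = 0, p 1%N = c 0%N, p 2%N = c 1%N & p 3%N = c 2%N].
  by split; rewrite /p /row_cubic !mxE !inordK.
have [q0 q1 q2 q3] : [/\ q 0%N = - c 0%N, q 1%N = 0, q 2%N = c 3%N & q 3%N = c 4%N].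
  by split; rewrite /q /row_cubic !mxE !inordK.
pose g (x : K) := c 0%N * x ^+ 2 + c 1%N * x + c 2%N.
pose e := sqrtC (c 1%N ^+ 2 - 4%:R * c 0%N * c 2%N).
have ee : e ^+ 2 = c 1%N ^+ 2 - 4%:R * c 0%N * c 2%N by exact: sqrtCK.
have nze : e != 0 by rewrite -sqrf_eq0 ee.
pose r1 := (- c 1%N + e) / (2%:R * c 0%N); pose r2 := (- c 1%N - e) / (2%:R * c 0%N).
have nz2 : 2%:R * c 0%N != 0 by rewrite mulf_neq0 // pnatr_eq0.
have gE x : g x = c 0%N * ((x - r1) * (x - r2)).
  have -> : g x = c 0%N * x ^+ 2 + c 1%N * x + (c 1%N ^+ 2 - e ^+ 2) / (4%:R * c 0%N).
    by rewrite /g ee; field.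
  by rewrite /r1 /r2; field.
have r12 : r1 != r2.
  rewrite -subr_eq0; have -> : r1 - r2 = e / c 0%N by rewrite /r1 /r2; field.
  by rewrite mulf_neq0 // invr_eq0.
have cubp a b : cub p a b = b * (c 0%N * a ^+ 2 + c 1%N * a * b + c 2%N * b ^+ 2).
  by rewrite /cub p0 p1 p2 p3; ring.
have nzq x : g x = 0 -> cub q x 1 != 0.
  move=> gx; apply: contraNneq nzr => q0'.
  have eab : al * x = - be.
    (* Division of [c 0 * q] by the quadratic factor, whose remainder is al s + be t. *)
    have : al * x + be = c 0%N * cub q x 1 + (c 0%N * x - c 1%N) * g x.
      by rewrite /cub q0 q1 q2 q3 /g /al /be; ring.
    by rewrite q0' gx !mulr0 addr0 => /eqP; rewrite addr_eq0 => /eqP.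
  have -> : be = - (al * x) by rewrite eab opprK.
  by apply/eqP; rewrite -(mulr0 (al ^+ 2)) -gx /g; ring.
have nzJ x : g x = 0 -> jac p q x 1 != 0.
  move=> gx; have nzs : cub_ds p x 1 != 0.
    rewrite -sqrf_eq0.
    have -> : cub_ds p x 1 ^+ 2 = (c 1%N ^+ 2 - 4%:R * c 0%N * c 2%N) + 4%:R * c 0%N * g x.
      by rewrite /cub_ds p0 p1 p2 /g; ring.
    by rewrite gx mulr0 addr0.
  have cp0 : cub p x 1 = 0 by rewrite cubp -[RHS](mulr0 1) -gx /g; ring.
  have -> : jac p q x 1 = - (3%:R * cub q x 1 * cub_ds p x 1).
    rewrite -euler_cub /jac.
    have -> : cub_dt p x 1 = - x * cub_ds p x 1.
      by apply/eqP; rewrite -subr_eq0 -(mulr0 3%:R) -cp0 -euler_cub; apply/eqP; ring.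
    by ring.
  by rewrite oppr_eq0 !mulf_neq0 ?pnatr_eq0 ?nzq.
have g1 : g r1 = 0 by rewrite gE subrr mul0r mulr0.
have g2 : g r2 = 0 by rewrite gE subrr !mulr0.
apply: (@has_points_of_roots m (fun i => nth 0 [:: 1; r1; r2] i)
                               (fun i => nth 0 [:: 0; 1; 1] i)) => //;
  rewrite -/p -/q.
- case=> [[|[|[|//]]] ?] /=; rewrite cubp ?mul0r //.
    by rewrite -[RHS](mulr0 1) -g1 /g; ring.
  by rewrite -[RHS](mulr0 1) -g2 /g; ring.
- case=> [[|[|[|//]]] ?] /=; [|exact: nzq|exact: nzq].
  by rewrite /cub q0 !(expr0n, expr1n, mulr0, addr0, mulr1) /= oppr_eq0.
- case=> [[|[|[|//]]] ?] /=; [|exact: nzJ|exact: nzJ].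
  have -> : jac p q 1 0 = - (3%:R * c 0%N * c 0%N).
    by rewrite /jac /cub_ds /cub_dt p0 p1 q0 q1; ring.
  by rewrite oppr_eq0 !mulf_neq0 ?pnatr_eq0.
- case=> [[|[|[|//]]] ?]; case=> [[|[|[|//]]] ?] /=;
    rewrite ?(mul1r, mulr1, mulr0, mul0r) => h; apply/val_inj => //=;
    move: h => /eqP; rewrite ?oner_eq0 ?[0 == 1]eq_sym ?oner_eq0
      ?[r2 == r1]eq_sym ?(negbTE r12) //.
move=> a b; rewrite cubp => /eqP; rewrite mulf_eq0 => /orP [/eqP b0 _|/eqP e0 nzab].
  by exists (inord 0), a; rewrite b0 inordK //= mulr1 mulr0.
have [b0|nzb] := eqVneq b 0.
  case/eqP: nzab; move: e0; rewrite b0 expr0n /= !mulr0 !addr0 => /eqP.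
  by rewrite mulf_eq0 (negbTE nz0) sqrf_eq0 => /eqP ->.
have : g (a / b) = 0.
  apply: (mulIf (expf_neq0 2 nzb)); rewrite mul0r -[RHS]e0 /g; field; exact: nzb.
rewrite gE => /eqP; rewrite !mulf_eq0 (negbTE nz0) /= !subr_eq0.
move=> /orP [] /eqP er; [exists (inord 1), b | exists (inord 2), b];
  by rewrite inordK //= -er mulr1 mulrC divfK.
Qed.

End Count.

(** * Homogeneity, partial degrees and the degree of the map *)

Section Weights.
Variables (n : nat) (R : comNzRingType).
Implicit Types (p : {mpoly R[n]}) (A : pred 'I_n).

(** Multiplies the variables in [A] by an auxiliary variable, whose exponents then
    record the degree in these variables. *)
Definition weigh A : {mpoly R[n]} -> {poly {mpoly R[n]}} :=
  mmap (polyC \o @mpolyC n R)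
       (fun i => if A i then 'X * ('X_i)%:P else ('X_i)%:P).

HB.instance Definition _ A := GRing.RMorphism.on (weigh A).

Lemma coef_weigh A p e m :
  ((weigh A p)`_e)@_m = if \sum_(i | A i) m i == e then p@_m else 0.
Proof.
rewrite /weigh /mmap coef_sum raddf_sum /=.
have E k : ((p@_k)%:MP%:P * mmap1 (fun i => if A i then 'X * ('X_i)%:P else ('X_i)%:P) k)`_e
    = if \sum_(i | A i) k i == e then p@_k *: 'X_[k] else 0.
  have -> : mmap1 (fun i => if A i then 'X * ('X_i)%:P else ('X_i)%:P) k =
      ('X_[k] : {mpoly R[n]})%:P * 'X^(\sum_(i | A i) k i).
    rewrite -prodrXr big_mkcond mpolyXE_id rmorph_prod -big_split /=.
    apply: eq_bigr => i _; rewrite rmorphXn /=.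
    by case: ifP => _; rewrite ?mulr1 // exprMn mulrC.
  rewrite mulrA -polyCM coefCM coefXn eq_sym.
  by case: eqP => _; rewrite ?mulr1 ?mulr0 // mul_mpolyC.
under eq_bigr do rewrite E.
have [pm|pm] := boolP (m \in msupp p); last first.
  rewrite (memN_msupp_eq0 pm) if_same big_seq big1 // => k kp.
  case: eqP => _; last by rewrite mcoeff0.
  rewrite mcoeffZ mcoeffX; case: eqP => [ek|_]; last by rewrite mulr0.
  by rewrite -ek kp in pm.
rewrite (bigD1_seq m) ?msupp_uniq //= [X in _ + X]big1 ?addr0.
  by case: eqP => _; rewrite ?mcoeff0 // mcoeffZ mcoeffX eqxx mulr1.
move=> k nk; case: eqP => _; rewrite ?mcoeff0 // mcoeffZ mcoeffX.
by rewrite (negbTE nk) mulr0.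
Qed.

Lemma weighX A i : weigh A 'X_i = if A i then 'X * ('X_i)%:P else ('X_i)%:P.
Proof. by rewrite /weigh mmapX mmap1U. Qed.

Lemma dhomog_weigh p d : weigh xpredT p = 'X^d * p%:P -> p \is d.-homog.
Proof.
move=> e; apply/dhomogP => m pm; apply/eqP; rewrite -[_ == _]negbK; apply/negP => nd.
have := coef_weigh xpredT p (mdeg m) m; rewrite e -mdegE eqxx mulrC coefCM coefXn.
by rewrite (negbTE nd) mulr0 mcoeff0 => /esym/eqP; apply/negP; rewrite -mcoeff_msupp.
Qed.

Definition generic_pt : 'cV[{mpoly R[n]}]_n := \col_i 'X_i.

Lemma map_generic_pt_meval (v : 'cV[R]_n) : map_mx (meval (fun i => v i 0)) generic_pt = v.
Proof. by apply/colP => i; rewrite !mxE mevalXU. Qed.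

End Weights.

(** A function of the coordinates that is compatible with ring morphisms is a
    polynomial, its value at the generic point; that polynomial is homogeneous
    when the function scales as it should over every ring, in particular over
    the ring that contains the auxiliary variable of [weigh]. *)
Lemma natural_homog n d (G : forall R : comNzRingType, 'cV[R]_n -> R) :
  (forall (R S : comNzRingType) (f : {rmorphism R -> S}) v,
     f (G R v) = G S (map_mx f v)) ->
  (forall (R : comNzRingType) (c : R) v, G R (c *: v) = c ^+ d * G R v) ->
  forall R : comNzRingType, G _ (generic_pt n R) \is d.-homog.
Proof.
move=> nat sc R; apply: dhomog_weigh.
pose w : {rmorphism {mpoly R[n]} -> {poly {mpoly R[n]}}} := @weigh n R xpredT.
pose C : {rmorphism {mpoly R[n]} -> {poly {mpoly R[n]}}} := @polyC {mpoly R[n]}.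
have -> : weigh xpredT (G _ (generic_pt n R)) = w (G _ (generic_pt n R)) by [].
have -> : (G _ (generic_pt n R))%:P = C (G _ (generic_pt n R)) by [].
rewrite !nat -sc; congr (G _ _); apply/colP => i.
by rewrite !mxE [LHS]weighX.
Qed.

Section Map.
Variables (R S : comNzRingType) (f : {rmorphism R -> S}).

Lemma map_Mmx m : map_mx f (Mmx m) = Mmx (map_mx f m).
Proof.
by rewrite map_mx_of_rows /= !rmorph0 !rmorphN /Mmx ![map_mx _ _ _ _]mxE.
Qed.

Lemma map_iota_tw m : map_mx f (iota_tw m) = iota_tw (map_mx f m).
Proof. by rewrite /iota_tw map_chow_form map_Mmx. Qed.

Lemma map_genericity m : f (genericity m) = genericity (map_mx f m).
Proof.
by rewrite /genericity -map_Mmx det_map_mx ![map_mx _ _ _ _]mxE; ring.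
Qed.

End Map.

Lemma genericityZ (R : comNzRingType) (c : R) m : genericity (c *: m) = c ^+ 12 * genericity m.
Proof. by rewrite /genericity MmxZ detZ !mxE; ring. Qed.

Lemma size_factor_polyC (D : idomainType) (p q : {poly D}) (c : D) :
  c != 0 -> p * q = c%:P -> (size p <= 1)%N.
Proof.
move=> nzc e; have nz : p * q != 0 by rewrite e polyC_eq0.
have := size_polyC c; rewrite -e nzc size_mul; last 2 first.
- by apply: contraNneq nz => ->; rewrite mul0r.
- by apply: contraNneq nz => ->; rewrite mulr0.
have : (0 < size q)%N.
  by rewrite size_poly_gt0; apply: contraNneq nz => ->; rewrite mulr0.
by move: (size p) (size q) => x y; lia.
Qed.

Section Degree.
Variable K : fieldType.

(** Degrees in the variables of [A] add up in a product, so a factor of a nonzero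
    polynomial of degree 0 in these variables has degree 0 in them as well. *)
Lemma weigh_factor n (A : pred 'I_n) (g h f : {mpoly K[n]}) m :
  f = g * h -> f != 0 -> weigh A f = f%:P -> m \in msupp g ->
  \sum_(i | A i) m i = 0%N.
Proof.
move=> fgh nzf wf gm.
have szg : (size (weigh A g) <= 1)%N.
  by apply: (@size_factor_polyC _ _ (weigh A h) f nzf); rewrite -rmorphM -fgh.
have := coef_weigh A g (\sum_(i | A i) m i) m; rewrite eqxx.
case: (\sum_(i | A i) m i)%N => // e.
rewrite nth_default ?mcoeff0; last exact: leq_trans szg _.
by move/esym/eqP; rewrite mcoeff_eq0 gm.
Qed.

Lemma iota_tw_nu3 (R : comNzRingType) (m : 'cV[R]_13) (L : 'cV[R]_6) :
  \sum_k iota_tw m k 0 * nu3 L k 0 = tw_eval (dual_wedge2 (Mmx m) *m L).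
Proof.
by rewrite -chow_formP mxE; apply: eq_bigr => k _; rewrite [_^T _ _]mxE.
Qed.

(** The coefficient of the cube of the [j]-th Pluecker coordinate in the Chow
    form of [Mmx m], obtained as the value of that form at a basis vector. *)
Definition cube_coef (R : comNzRingType) (j : 'I_6) (m : 'cV[R]_13) : R :=
  tw_eval (dual_wedge2 (Mmx m) *m delta_mx j 0).

Lemma map_cube_coef (R S : comNzRingType) (f : {rmorphism R -> S}) j m :
  f (cube_coef j m) = cube_coef j (map_mx f m).
Proof.
by rewrite /cube_coef map_tw_eval map_mxM map_dual_wedge2 map_Mmx map_delta_mx.
Qed.

Lemma delta_colE (R : comNzRingType) (M : 'M[R]_6) i j :
  (M *m delta_mx j 0 : 'cV_6) i 0 = M i j.
Proof. by rewrite -colE mxE. Qed.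

(** The first column of [dual_wedge2 M] consists of the minors of the last two
    rows of [M]. *)
Lemma cube_coef0 (R : comNzRingType) (m m' : 'cV[R]_13) :
  (forall i : 'I_13, (5 <= i)%N -> m i 0 = m' i 0) ->
  cube_coef 0 m = cube_coef 0 m'.
Proof.
move=> e; rewrite /cube_coef -!colE; congr (tw_eval _); apply/colP => k.
rewrite [LHS]mxE [RHS]mxE !dual_wedge2E ![wedge2 _ _ _]mxE.
have -> : pl_fst (rev_ord 0) = inord 2 by [].
have -> : pl_snd (rev_ord 0) = inord 3 by [].
have E i (j : 'I_4) : (1 < i < 4)%N -> Mmx m (inord i) j = Mmx m' (inord i) j.
  case: i => [|[|[|[|//]]]] // _; rewrite !mxE !inordK //;
    by case: j => [[|[|[|[|//]]]] ?] //=; apply: e; rewrite inordK.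
by rewrite !E.
Qed.

(** The last column of [dual_wedge2 M] consists of the minors of the first two
    rows of [M]. *)
Lemma cube_coef5 (R : comNzRingType) (m m' : 'cV[R]_13) :
  (forall i : 'I_13, (i < 5)%N -> m i 0 = m' i 0) ->
  cube_coef ord_max m = cube_coef ord_max m'.
Proof.
move=> e; rewrite /cube_coef -!colE; congr (tw_eval _); apply/colP => k.
rewrite [LHS]mxE [RHS]mxE !dual_wedge2E ![wedge2 _ _ _]mxE.
have -> : rev_ord (ord_max : 'I_6) = ord0 by apply/val_inj.
have -> : pl_fst ord0 = inord 0 by [].
have -> : pl_snd ord0 = inord 1 by [].
have E i (j : 'I_4) : (i < 2)%N -> Mmx m (inord i) j = Mmx m' (inord i) j.
  case: i => [|[|//]] _; rewrite !mxE !inordK //;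
    by case: j => [[|[|[|[|//]]]] ?] //=; rewrite e // inordK.
by rewrite !E.
Qed.

Lemma weigh_cube_coef (A : pred 'I_13) j :
  (forall (R : comNzRingType) (m m' : 'cV[R]_13),
     (forall i, ~~ A i -> m i 0 = m' i 0) -> cube_coef j m = cube_coef j m') ->
  weigh A (cube_coef j (generic_pt 13 K)) = (cube_coef j (generic_pt 13 K))%:P.
Proof.
move=> h.
pose w : {rmorphism {mpoly K[13]} -> {poly {mpoly K[13]}}} := @weigh 13 K A.
pose C : {rmorphism {mpoly K[13]} -> {poly {mpoly K[13]}}} := @polyC {mpoly K[13]}.
have -> : weigh A (cube_coef j (generic_pt 13 K)) = w (cube_coef j (generic_pt 13 K)) by [].
have -> : (cube_coef j (generic_pt 13 K))%:P = C (cube_coef j (generic_pt 13 K)) by [].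
rewrite !map_cube_coef; apply: h => i nA; rewrite !mxE.
by rewrite [LHS]weighX (negbTE nA).
Qed.

Lemma cube_coef_generic_neq0 j (m : 'cV[K]_13) :
  cube_coef j m != 0 -> cube_coef j (generic_pt 13 K) != 0.
Proof.
apply: contraNneq => e; have := map_cube_coef (meval (fun i => m i 0)) j (generic_pt 13 K).
by rewrite map_generic_pt_meval e rmorph0 => /esym ->.
Qed.

Lemma cube_coef0_neq0 :
  cube_coef 0 (\col_i ((i == 5 :> nat) || (i == 12 :> nat))%:R : 'cV[K]_13) != 0.
Proof.
set m := \col__ _.
have E k : (k < 6)%N -> (dual_wedge2 (Mmx m) *m delta_mx (0 : 'I_6) (0 : 'I_1)) (inord k) 0 =
    (k == 3)%:R :> K.
  move=> hk; rewrite delta_colE dual_wedge2E mxE.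
  case: k hk => [|[|[|[|[|[|//]]]]]] _; rewrite /pl_fst /pl_snd /= !inordK //=
    /m !mxE ?inordK //= ?mxE ?inordK //=; ring.
rewrite /cube_coef tw_evalE !E //= [X in X != 0](_ : _ = -1); last by ring.
by rewrite oppr_eq0 oner_eq0.
Qed.

Lemma cube_coef5_neq0 :
  cube_coef ord_max (\col_i ((i == 0 :> nat) || (i == 2 :> nat))%:R : 'cV[K]_13) != 0.
Proof.
set m := \col__ _.
have E k : (k < 6)%N -> (dual_wedge2 (Mmx m) *m delta_mx (ord_max : 'I_6) (0 : 'I_1)) (inord k) 0 =
    (k == 3)%:R + (k == 5)%:R :> K.
  move=> hk; rewrite delta_colE dual_wedge2E mxE.
  case: k hk => [|[|[|[|[|[|//]]]]]] _; rewrite /pl_fst /pl_snd /= !inordK //=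
    /m !mxE ?inordK //= ?mxE ?inordK //=; ring.
rewrite /cube_coef tw_evalE !E //= [X in X != 0](_ : _ = -1); last by ring.
by rewrite oppr_eq0 oner_eq0.
Qed.

(** A common factor divides every linear combination of the coefficients, in
    particular the two [cube_coef] that share no variable; by [weigh_factor] it
    has degree 0 in each of the two complementary sets of variables. *)
Lemma iota_tw_degree : rational_map_of_degree 6 (@iota_tw K).
Proof.
exists (fun k => iota_tw (generic_pt 13 K) k 0); split.
- move=> k; apply: (@natural_homog 13 6 (fun R v => iota_tw v k 0)).
    by move=> R S f v; rewrite -map_iota_tw [RHS]mxE.
  by move=> R c v; rewrite /iota_tw MmxZ chow_formZ; exact: mxE.
- move=> g div_g.
  have div_row j : exists h, cube_coef j (generic_pt 13 K) = g * h.
    rewrite /cube_coef -iota_tw_nu3.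
    have [h eh] : exists h : 'I_56 -> {mpoly K[13]},
        forall k, iota_tw (generic_pt 13 K) k 0 = g * h k.
      exact: (@fin_all_exists 'I_56 (fun=> {mpoly K[13]})
        (fun k h => iota_tw (generic_pt 13 K) k 0 = g * h)).
    exists (\sum_k h k * nu3 (delta_mx j 0) k 0); rewrite mulr_sumr.
    by apply: eq_bigr => k _; rewrite eh mulrA.
  have nz0 := cube_coef_generic_neq0 cube_coef0_neq0.
  have nz5 := cube_coef_generic_neq0 cube_coef5_neq0.
  have w0 : weigh (fun i : 'I_13 => (i < 5)%N) (cube_coef 0 (generic_pt 13 K)) =
    (cube_coef 0 (generic_pt 13 K))%:P.
    by apply: weigh_cube_coef => R m m' e;
      apply: cube_coef0 => i hi; apply: e; rewrite -leqNgt.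
  have w5 : weigh (fun i : 'I_13 => (5 <= i)%N) (cube_coef ord_max (generic_pt 13 K)) =
    (cube_coef ord_max (generic_pt 13 K))%:P.
    by apply: weigh_cube_coef => R m m' e;
      apply: cube_coef5 => i hi; apply: e; rewrite -ltnNge.
  have [h0 e0] := div_row 0; have [h5 e5] := div_row ord_max.
  have supp m : m \in msupp g -> m = 0%MM.
    move=> gm; apply/mnmP => i; rewrite mnm0E.
    have := weigh_factor e0 nz0 w0 gm; have := weigh_factor e5 nz5 w5 gm.
    move/eqP; rewrite sum_nat_eq0 => /forallP /(_ i) h1.
    move/eqP; rewrite sum_nat_eq0 => /forallP /(_ i) h2.
    by case: (ltnP i 5) h1 h2 => _ /= h1 h2; apply/eqP.
  exists (g@_0%MM); apply/mpolyP => m; rewrite mcoeffC.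
  case: eqP => [<-|nm]; first by rewrite mulr1.
  rewrite mulr0; apply: memN_msupp_eq0; apply/negP => /supp e.
  by case: nm; rewrite e.
move=> v k; have := map_iota_tw (meval (fun i => v i 0)) (generic_pt 13 K).
by rewrite map_generic_pt_meval => <-; rewrite [LHS]mxE.
Qed.

End Degree.

(** * Closures and dominance *)

Section Closure.
Variable K : numClosedFieldType.
Implicit Types (M A B : 'M[K]_4).

Lemma meval_dhomogZ n d (f : {mpoly K[n]}) c (v : 'cV[K]_n) : f \is d.-homog ->
  f.@[fun i => (c *: v) i 0] = c ^+ d * f.@[fun i => v i 0].
Proof.
move=> /dhomogP hf; rewrite !mevalE mulr_sumr big_seq [RHS]big_seq.
apply: eq_bigr => m mf; rewrite mulrCA; congr (_ * _).
under eq_bigr do rewrite mxE exprMn.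
by rewrite big_split /= prodrXr -mdegE (hf m mf : mdeg m = d).
Qed.

Lemma proj_closedZ n (Z : 'cV[K]_n -> Prop) c v :
  proj_closed Z -> c != 0 -> Z v -> Z (c *: v).
Proof.
case=> I homI ZE nzc /ZE [nzv fv]; apply/ZE; split.
  by rewrite scaler_eq0 negb_or nzc.
move=> f If; have [d hf] := homI f If.
by rewrite (meval_dhomogZ _ _ hf) fv // mulr0.
Qed.

Lemma proj_closed_eq n (Z : 'cV[K]_n -> Prop) u v :
  proj_closed Z -> proj_eq u v -> Z v -> Z u.
Proof. by move=> cZ [c nzc ->]; exact: proj_closedZ. Qed.

Lemma horner_mmap n (g : 'I_n -> {poly K}) (f : {mpoly K[n]}) t :
  (mmap (@polyC K) g f).[t] = f.@[fun i => (g i).[t]].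
Proof.
rewrite /meval /mmap horner_sum; apply: eq_bigr => m _.
rewrite hornerM hornerC horner_prod; congr (_ * _).
by apply: eq_bigr => i _; rewrite horner_exp.
Qed.

(** The value of [f] at the Chow form of [A + t B] is a polynomial in t.  Multiplied
    by [Q] and by a coordinate of the Chow form that is nonzero at t = 0, it
    vanishes everywhere, hence it is zero. *)
Lemma chow_form_line (f : {mpoly K[56]}) A B (Q : {poly K}) :
  Q != 0 -> chow_form A != 0 ->
  (forall t, Q.[t] != 0 -> chow_form (A + t *: B) != 0 ->
     f.@[fun i => chow_form (A + t *: B) i 0] = 0) ->
  f.@[fun i => chow_form A i 0] = 0.
Proof.
move=> nzQ nzA h.
pose AB := map_mx (@polyC K) A + 'X *: map_mx (@polyC K) B.
have ABt t i : (chow_form AB i 0).[t] = chow_form (A + t *: B) i 0.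
  pose ev : {rmorphism {poly K} -> K} := horner_eval t.
  have -> : (chow_form AB i 0).[t] = map_mx ev (chow_form AB) i 0 by rewrite [RHS]mxE.
  rewrite map_chow_form; congr (chow_form _ i 0).
  by apply/matrixP => j k; rewrite !mxE /ev /= /horner_eval !hornerE.
have [k nzk] : exists k, chow_form A k 0 != 0.
  apply/existsP; apply: contraNT nzA; rewrite negb_exists => /forallP h0.
  by apply/eqP/colP => k; rewrite [RHS]mxE; apply/eqP; rewrite -[_ == _]negbK h0.
pose P := mmap (@polyC K) (fun i => chow_form AB i 0) f.
have P0 : P.[0] = f.@[fun i => chow_form A i 0].
  by rewrite horner_mmap; apply: meval_eq => i; rewrite ABt scale0r addr0.
have nzC : chow_form AB k 0 != 0.
  by apply: contraNneq nzk => e; rewrite -[A]addr0 -(scale0r B) -ABt e horner0.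
suff /eqP : Q * chow_form AB k 0 * P = 0.
  by rewrite !mulf_eq0 (negbTE nzQ) (negbTE nzC) -P0 => /eqP ->; rewrite horner0.
apply: poly_fun_eq0 => t; rewrite !hornerM.
have [->|nzt] := eqVneq Q.[t] 0; first by rewrite !mul0r.
have [->|nzct] := eqVneq (chow_form AB k 0).[t] 0; first by rewrite mulr0 mul0r.
have Pt : P.[t] = f.@[fun i => chow_form (A + t *: B) i 0].
  by rewrite horner_mmap; exact: meval_eq (ABt t).
have nzAt : chow_form (A + t *: B) != 0.
  by apply: contraNneq nzct => e; rewrite ABt e mxE.
by rewrite Pt (h t nzt nzAt) mulr0.
Qed.

(** Up to finitely many exceptions, the matrices [M + t * 1] are invertible. *)
Lemma chow_form_closed_unit (Z : 'cV[K]_56 -> Prop) : proj_closed Z ->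
  (forall M, M \in unitmx -> Z (chow_form M)) ->
  forall M, chow_form M != 0 -> Z (chow_form M).
Proof.
move=> [I homI ZE] h M nzM; apply/ZE; split=> // f If.
apply: (@chow_form_line f M 1%:M (char_poly (- M))) => //.
  exact: monic_neq0 (char_poly_monic _).
move=> t; have -> : (char_poly (- M)).[t] = \det (M + t *: 1%:M).
  rewrite /char_poly /char_poly_mx.
  pose ev : {rmorphism {poly K} -> K} := horner_eval t.
  have -> (p : {poly K}) : p.[t] = ev p by [].
  rewrite -det_map_mx; congr (\det _).
  apply/matrixP => i j; rewrite !mxE /ev /= /horner_eval !hornerE.
  by case: (i == j); rewrite ?mulr1n ?mulr0n !hornerE; ring.
move=> nzd _; have /ZE [_] : Z (chow_form (M + t *: 1%:M)); last by apply.
by apply: h; rewrite unitmxE unitfE.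
Qed.

(** The pair (a, c) is the root; (b, d) completes it to an invertible matrix. *)
Lemma cubic_root (u : nat -> K) : exists a b c d, cub u a c = 0 /\ a * d - b * c != 0.
Proof.
have [u0|nz] := eqVneq (u 0%N) 0.
  exists 1, 0, 0, 1; split; last by rewrite mulr1 mulr0 subr0 oner_eq0.
  by rewrite /cub u0; ring.
pose p := \poly_(i < 4) u (3 - i)%N.
have sp : size p = 4%N by rewrite size_poly_eq.
have [x /rootP rx] : exists x, root p x by apply/closed_rootP; rewrite sp.
exists x, (-1), 1, 0; split; last by rewrite mulr0 mulr1 sub0r opprK oner_eq0.
rewrite -[RHS]rx horner_poly !big_ord_recl big_ord0 /= /bump /= /cub; ring.
Qed.

(** First for matrices with [M_00 = 0], along the line that makes [M_01] and
    [M_10] generic and keeps [M_00 = 0]; then in general, after a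
    reparametrisation that moves a root of the first row to (1 : 0). *)
Lemma chow_form_closed_iota (Z : 'cV[K]_56 -> Prop) : proj_closed Z ->
  (forall m, iota_tw m != 0 -> Z (iota_tw m)) ->
  forall M, chow_form M != 0 -> Z (chow_form M).
Proof.
move=> cZ h.
have h00 M : row_cubic M 0 0 = 0 -> chow_form M != 0 -> Z (chow_form M).
  case: {-1}cZ => I homI ZE M00 nzM; apply/ZE; split=> // f If.
  pose B : 'M[K]_4 := delta_mx (inord 0) (inord 1) + delta_mx (inord 1) (inord 0).
  apply: (@chow_form_line f M B
    (('X + (row_cubic M 0 1)%:P) * ('X + (row_cubic M 1 0)%:P))) => //.
    by rewrite mulf_neq0 // monic_neq0 // monicXaddC.
  move=> t; set N := M + t *: B; rewrite hornerM !hornerE mulf_eq0 negb_or.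
  move=> /andP [nz01 nz10] nzN.
  have N00 : row_cubic N 0 0 = 0.
    rewrite /row_cubic /N !mxE -!val_eqE /= !inordK // -/(row_cubic M 0 0) M00 /=; ring.
  have N01 : row_cubic N 0 1 = t + row_cubic M 0 1.
    by rewrite /row_cubic /N !mxE -!val_eqE /= !inordK //=; ring.
  have N10 : row_cubic N 1 0 = t + row_cubic M 1 0.
    by rewrite /row_cubic /N !mxE -!val_eqE /= !inordK //=; ring.
  have root0 : cub (row_cubic N 0) 1 0 = 0 by rewrite /cub N00; ring.
  pose k := (- (3%:R * jac (row_cubic N 0) (row_cubic N 1) 1 0
                * cub (row_cubic N 1) 1 0 ^+ 2)) ^+ 9.
  have ek : chow_form (N *m adapt N 1 0) = k *: chow_form N.
    exact: chow_form_adapt.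
  have nzk : k != 0.
    rewrite /k expf_neq0 // oppr_eq0.
    have -> : jac (row_cubic N 0) (row_cubic N 1) 1 0 =
        3%:R * row_cubic N 1 0 * row_cubic N 0 1.
      by rewrite /jac /cub_ds /cub_dt N00; ring.
    have -> : cub (row_cubic N 1) 1 0 = row_cubic N 1 0 by rewrite /cub; ring.
    by rewrite !mulf_neq0 ?expf_neq0 ?pnatr_eq0 // ?N01 ?N10.
  have iE : iota_tw (unMmx (N *m adapt N 1 0)) = k *: chow_form N.
    by rewrite /iota_tw unMmxK //; exact: adapt_normal.
  have nzi : iota_tw (unMmx (N *m adapt N 1 0)) != 0.
    by rewrite iE scaler_eq0 negb_or nzk.
  have : Z (chow_form N).
    apply: (@proj_closed_eq _ _ _ (k *: chow_form N) cZ); last by rewrite -iE; exact: h.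
    by exists k^-1; rewrite ?invr_eq0 // scalerA mulVf // scale1r.
  by case/ZE => _; apply.
move=> M nzM; have [a [b [c [d [p0 nzd]]]]] := cubic_root (row_cubic M 0).
have nzd9 : (a * d - b * c) ^+ 9 != 0 by rewrite expf_neq0.
apply: (@proj_closed_eq _ _ _ (chow_form (M *m sym3 a b c d)) cZ).
  exists ((a * d - b * c) ^- 9); first by rewrite invr_eq0.
  by rewrite chow_form_sym3 scalerA mulVf // scale1r.
apply: h00; first by rewrite mul_sym3_col0.
by rewrite chow_form_sym3 scaler_eq0 negb_or nzd9.
Qed.

Lemma Ch_tw_chow_form M : chow_form M != 0 -> Ch_tw (chow_form M).
Proof.
move=> nzM; split=> // Z cZ h; apply: (chow_form_closed_unit cZ) => // N uN.
apply: h; first exact: chow_form_unit.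
exists N; first by apply/eqP; rewrite -[_ == _]/(row_free N) row_free_unit.
by exists 1; rewrite ?oner_eq0 // scale1r.
Qed.

Lemma iota_tw_maps_into : maps_into (@iota_tw K) (@Ch_tw K).
Proof. by move=> m [_]; exact: Ch_tw_chow_form. Qed.

Lemma iota_tw_dominant : dominant (@iota_tw K) (@Ch_tw K).
Proof.
move=> w; split=> -[nzw hw]; split=> // Z cZ h; apply: hw => // u nzu.
  move=> [m dm eu]; apply: (proj_closed_eq cZ eu).
  by case: (iota_tw_maps_into dm) => _; apply.
move=> [M rM eu]; apply: (proj_closed_eq cZ eu).
apply: (chow_form_closed_iota cZ) => [m nzm|].
  apply: h => //; exists m; first exact: iota_tw_domain.
  by exists 1; rewrite ?oner_eq0 // scale1r.
by case: eu => c _ eu; apply: contraNneq nzu => e; rewrite eu e scaler0.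
Qed.

Lemma iota_tw_generically_3_to_1 : generically_to_one 3 (@iota_tw K).
Proof.
pose D : {mpoly K[13]} := genericity (generic_pt 13 K).
have hD : D \is 12.-homog.
  apply: (@natural_homog 13 12 (fun R m => genericity m)).
    by move=> R S f v; exact: map_genericity.
  by move=> R c v; exact: genericityZ.
have DE (v : 'cV_13) : D.@[fun i => v i 0] = genericity v.
  by have := map_genericity (meval (fun i => v i 0)) (generic_pt 13 K);
     rewrite map_generic_pt_meval.
exists (fun v => v != 0 /\ genericity v != 0); split;
  last by move=> v [_]; exact: generic_fiber.
  exists (fun v => v != 0 /\ genericity v = 0).
    exists (fun f => f = D); first by move=> f ->; exists 12%N.
    move=> v; split=> -[nzv hv]; split=> //; first by move=> f ->; rewrite DE.
    by rewrite -DE; exact: hv.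
  move=> v; split=> -[nzv hv]; split=> //; first by case=> _ /eqP; apply/negP.
  by apply/eqP => e; apply: hv.
(* p = t (s^2 - t^2) and q = - s^3 + s t^2 + t^3, completed to an invertible matrix. *)
pose v : 'cV[K]_13 := \col_i nth 0 [:: 1; 0; -1; 1; 1; 0; 0; 1; 0; 0; 0; 0; 1] i.
have nzdet : \det (Mmx v) != 0.
  pose N : 'M[K]_4 := mx_of_rows 4 4
    [:: [:: 0; -1; 1; 1]; [:: 1; 0; 0; 1]; [:: 0; 0; 1; 0]; [:: 0; 0; 0; 1]].
  have /mulmx1_unit [+ _] : Mmx v *m N = 1%:M; last by rewrite unitmxE unitfE.
  apply/matrixP; apply/forall_inord => i hi; apply/forall_inord => j hj.
  rewrite mxE sum_inord /index_iota /= !big_cons big_nil !mxE -val_eqE /= !inordK //.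
  by case: i hi => [|[|[|[|//]]]] _; case: j hj => [|[|[|[|//]]]] _ /=; ring.
have nzv : genericity v != 0.
  have -> : genericity v = 4%:R * \det (Mmx v).
    by rewrite /genericity !mxE !inordK //=; ring.
  by rewrite mulf_neq0 // pnatr_eq0.
exists v; split=> //; apply: contraNneq nzv => ->.
by rewrite -(scale0r (0 : 'cV_13)) genericityZ expr0n /= mul0r.
Qed.


End Closure.

Theorem theorem2p3 (R : realType) :
  [/\ rational_map_of_degree 6 (@iota_tw R[i]),
      maps_into (@iota_tw R[i]) (@Ch_tw R[i]),
      generically_to_one 3 (@iota_tw R[i])
    & dominant (@iota_tw R[i]) (@Ch_tw R[i])].
Proof.
split.
- exact: iota_tw_degree.
- exact: iota_tw_maps_into.
- exact: iota_tw_generically_3_to_1.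
exact: iota_tw_dominant.
Qed.
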